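(* Let $\mathfrak{g}$ be a $3$-dimensional centerless, solvable real Lie algebra and $G$ a connected Lie group with Lie algebra $\mathfrak{g}$ and a left-invariant Riemannian metric. Let $\mathcal{V}$ be a local conformal foliation by geodesics on $G$ (that is, a conformal foliation by geodesics of some non-empty connected open subset of $G$). Then $G$ has constant sectional curvature.
   Context: Let $\mathcal{V}$ be an involutive distribution on a Riemannian manifold $(M,g)$ (identified with the corresponding foliation), $\mathcal{H}$ its orthogonal complement, and use $\mathcal{V},\mathcal{H}$ also for the orthogonal projections onto these subbundles. Put $$B^{\mathcal{V}}(U,V)=\tfrac12\mathcal{H}(\nabla_UV+\nabla_VU)\ (U,V\in\mathcal{V}),\qquad B^{\mathcal{H}}(X,Y)=\tfrac12\mathcal{V}(\nabla_XY+\nabla_YX)\ (X,Y\in\mathcal{H}).$$ $\mathcal{V}$ is conformal if there is a vector field $V$ tangent to $\mathcal{V}$ with $B^{\mathcal{H}}=g\otimes V$. $\mathcal{V}$ is totally geodesic if $B^{\mathcal{V}}=0$. A conformal foliation by geodesics is a $1$-dimensional conformal and totally geodesic foliation. Centerless means that the center of $\mathfrak{g}$ is $\{0\}$. *)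

(* Defs.v *)
From HB Require Import structures.
From mathcomp Require Import all_boot all_order all_algebra.
From mathcomp Require Import all_classical all_reals all_analysis.
Import Order.TTheory GRing.Theory Num.Theory.
Import numFieldNormedType.Exports.

Set Implicit Arguments.
Unset Strict Implicit.
Unset Printing Implicit Defensive.

Local Open Scope classical_set_scope.
Local Open Scope ring_scope.

Section LieAlgebras.
Variables (R : realType) (L : vectType R).

Record lie_bracket := LieBracket {
  brk :> L -> L -> L;
  brk_linearl : forall z, linear (brk^~ z);
  brk_linearr : forall z, linear (brk z);
  brk_alt : forall x, brk x x = 0;
  brk_jacobi : forall x y z,
    brk x (brk y z) + brk y (brk z x) + brk z (brk x y) = 0 }.

Variable br : lie_bracket.

Definition centerless := [set x : L | forall y, br x y = 0] = [set 0].

(* By bilinearity, the brackets of basis vectors span all brackets. *)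
Definition derived_algebra (A : {vspace L}) : {vspace L} :=
  <<[seq br x y | x <- vbasis A, y <- vbasis A]>>%VS.

Definition solvable_lie_algebra :=
  exists k, iter k derived_algebra fullv = 0%VS.

End LieAlgebras.

Section SmoothFunctions.
Variables (R : realType) (V W : normedModType R).

(* Iterated Frechet differentiability. *)
Fixpoint ndifferentiable (k : nat) (O : set V) (f : V -> W) : Prop :=
  if k is k'.+1 then
    forall x, O x ->
      differentiable f x /\ forall v, ndifferentiable k' O (fun y => 'D_v f y)
  else True.

Definition smooth (O : set V) (f : V -> W) := forall k, ndifferentiable k O f.

End SmoothFunctions.

Record chart (R : realType) (n : nat) (M : Type) := Chart {
  chart_dom : set M;
  chart_map : M -> 'rV[R]_n;
  chart_inv : 'rV[R]_n -> M }.

Definition chart_im (R : realType) (n : nat) (M : Type) (c : chart R n M) :=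
  chart_map c @` chart_dom c.

Definition chart_ok (R : realType) (n : nat) (M : topologicalType)
    (c : chart R n M) :=
  [/\ open (chart_dom c), open (chart_im c),
      {in chart_dom c, cancel (chart_map c) (chart_inv c)},
      {within chart_dom c, continuous (chart_map c)} &
      {within chart_im c, continuous (chart_inv c)}].

HB.mixin Record isManifold (R : realType) (n : nat) M of Topological M := {
  atlas : set (chart R n M);
  manifold_hausdorff : hausdorff_space M;
  manifold_second_countable : @second_countable M;
  atlas_ok : forall c, atlas c -> chart_ok c;
  atlas_cover : forall p : M, exists2 c, atlas c & chart_dom c p;
  atlas_compat : forall c d, atlas c -> atlas d ->
    smooth (chart_map c @` (chart_dom c `&` chart_dom d))
           (fun z => chart_map d (chart_inv c z)) }.

#[short(type="manifoldType")]
HB.structure Definition Manifold (R : realType) (n : nat) :=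
  {M of isManifold R n M & Topological M}.

HB.mixin Record isLieGroup (R : realType) (n : nat) G
    of Manifold R n G & Group G := {
  mul_continuous : continuous (fun z : G * G => (z.1 * z.2)%g);
  mul_smooth : forall c d e : chart R n G, atlas c -> atlas d -> atlas e ->
    smooth [set z | [/\ chart_im c z.1, chart_im d z.2 &
                    chart_dom e (chart_inv c z.1 * chart_inv d z.2)%g]]
           (fun z => chart_map e (chart_inv c z.1 * chart_inv d z.2)%g);
  inv_continuous : continuous (fun x : G => x^-1%g);
  inv_smooth : forall c d : chart R n G, atlas c -> atlas d ->
    smooth [set z | chart_im c z /\ chart_dom d (chart_inv c z)^-1%g]
           (fun z => chart_map d (chart_inv c z)^-1%g) }.

#[short(type="lieGroupType")]
HB.structure Definition LieGroup (R : realType) (n : nat) :=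
  {G of isLieGroup R n G & Manifold R n G & Group G}.

Section Geometry.
Variables (R : realType) (n : nat) (M : manifoldType R n).

Definition smooth_on (W : set M) (f : M -> R) :=
  forall c : chart R n M, atlas c ->
    smooth (chart_map c @` (chart_dom c `&` W)) (f \o chart_inv c).

Definition smooth_at (p : M) (f : M -> R) :=
  exists W : set M, [/\ open W, W p & smooth_on W f].

(* Tangent vectors are represented by their action on functions; R^o gives
   the functionals their pointwise R-module structure. *)
Definition functional := (M -> R) -> R^o.

(* T_p M: directional derivatives in a chart, acting on functions smooth near
   p.  Sending all other functions to 0 makes the functional determined by its
   values on smooth germs, so that equality of functionals is equality of
   tangent vectors. *)
Definition tangent (p : M) : set functional :=
  [set v | exists (c : chart R n M) (w : 'rV[R]_n),
    [/\ atlas c, chart_dom c p & forall f, v f =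
      if `[< smooth_at p f >] then 'D_w (f \o chart_inv c) (chart_map c p)
      else 0]].

Definition vfield := M -> functional.

Definition smooth_vfield (W : set M) (X : vfield) :=
  (forall p, W p -> tangent p (X p)) /\
  (forall (W' : set M) (f : M -> R), open W' -> W' `<=` W -> smooth_on W' f ->
     smooth_on W' (fun p => X p f)).

Definition bracket (X Y : vfield) : vfield := fun p f =>
  if `[< smooth_at p f >] then X p (Y^~ f) - Y p (X^~ f) else 0.

Definition metric := M -> functional -> functional -> R.

Definition riemannian (g : metric) :=
  [/\ forall p a u v w, tangent p u -> tangent p v -> tangent p w ->
        g p (a *: u + v) w = a * g p u w + g p v w,
      forall p u v, tangent p u -> tangent p v -> g p u v = g p v u,
      forall p u, tangent p u -> u != 0 -> 0 < g p u u &
      forall (W : set M) X Y, open W -> smooth_vfield W X ->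
        smooth_vfield W Y -> smooth_on W (fun p => g p (X p) (Y p))].

Definition connection := vfield -> vfield -> vfield.

(* [nabla X Y] stands for the covariant derivative of Y along X; since W is an
   arbitrary open set, nabla also restricts to the Levi-Civita connection of
   each open submanifold. *)
Definition levi_civita (g : metric) (nabla : connection) :=
  forall (W : set M) (X Y Z : vfield) (f : M -> R), open W ->
    smooth_vfield W X -> smooth_vfield W Y -> smooth_vfield W Z ->
    smooth_on W f ->
    smooth_vfield W (nabla X Y) /\
    forall p, W p ->
    [/\ nabla (fun q => f q *: X q + Y q) Z p
          = f p *: nabla X Z p + nabla Y Z p,
        nabla X (Y + Z) p = nabla X Y p + nabla X Z p,
        nabla X (fun q => f q *: Y q) p
          = f p *: nabla X Y p + (X p f : R) *: Y p,
        nabla X Y p - nabla Y X p = bracket X Y p &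
        X p (fun q => g q (Y q) (Z q))
          = g p (nabla X Y p) (Z p) + g p (Y p) (nabla X Z p)].

Definition curvature (nabla : connection) (X Y Z : vfield) : vfield :=
  nabla X (nabla Y Z) - nabla Y (nabla X Z) - nabla (bracket X Y) Z.

Definition sectional (g : metric) (nabla : connection) (X Y : vfield) (p : M) :=
  g p (curvature nabla X Y Y p) (X p) /
  (g p (X p) (X p) * g p (Y p) (Y p) - g p (X p) (Y p) ^+ 2).

Definition constant_sectional_curvature (g : metric) (nabla : connection) :=
  exists kappa : R, forall (W : set M) (X Y : vfield) (p : M),
    open W -> smooth_vfield W X -> smooth_vfield W Y -> W p ->
    (forall a b : R, a *: X p + b *: Y p = 0 -> a = 0 /\ b = 0) ->
    sectional g nabla X Y p = kappa.

Definition subbundle := M -> set functional.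

Definition distribution (k : nat) (U : set M) (D : subbundle) :=
  forall p, U p -> exists (W : set M) (X : 'I_k -> vfield),
    [/\ open W, W p, W `<=` U, forall i, smooth_vfield W (X i) &
        forall q, W q ->
          (forall a : 'I_k -> R, \sum_i a i *: X i q = 0 -> forall i, a i = 0)
          /\ D q = [set v | exists a : 'I_k -> R, v = \sum_i a i *: X i q]].

Definition is_section (W : set M) (D : subbundle) (X : vfield) :=
  smooth_vfield W X /\ forall p, W p -> D p (X p).

Definition involutive_on (U : set M) (D : subbundle) :=
  forall (W : set M) (X Y : vfield), open W -> W `<=` U ->
    is_section W D X -> is_section W D Y ->
    forall p, W p -> D p (bracket X Y p).

Section Foliations.
Variables (g : metric) (nabla : connection).

Definition orth (D : subbundle) : subbundle := fun p =>
  [set v | tangent p v /\ forall u, D p u -> g p u v = 0].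

Definition oproj (D : subbundle) (p : M) (v : functional) : functional :=
  xget 0 [set w | D p w /\ forall u, D p u -> g p (v - w) u = 0].

(* B^V is [second_form (orth V)] on sections of V,
   and B^H is [second_form V] on sections of [orth V]. *)
Definition second_form (D : subbundle) (X Y : vfield) : vfield := fun p =>
  2^-1 *: oproj D p (nabla X Y p + nabla Y X p).

Definition conformal (U : set M) (D : subbundle) :=
  exists2 N, is_section U D N &
    forall (W : set M) (X Y : vfield), open W -> W `<=` U ->
      is_section W (orth D) X -> is_section W (orth D) Y ->
      forall p, W p -> second_form D X Y p = g p (X p) (Y p) *: N p.

Definition totally_geodesic (U : set M) (D : subbundle) :=
  forall (W : set M) (X Y : vfield), open W -> W `<=` U ->
    is_section W D X -> is_section W D Y ->
    forall p, W p -> second_form (orth D) X Y p = 0.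

Definition conformal_foliation_by_geodesics (U : set M) (D : subbundle) :=
  [/\ distribution 1 U D, involutive_on U D, conformal U D &
      totally_geodesic U D].

End Foliations.

End Geometry.

Section LeftInvariance.
Variables (R : realType) (n : nat) (G : lieGroupType R n).

Definition pushforward (F : G -> G) (v : functional G) : functional G :=
  fun f => v (f \o F).

Definition ltranslation (a : G) : G -> G := fun p => (a * p)%g.

Definition left_invariant_vfield (X : vfield G) :=
  smooth_vfield setT X /\
  forall a p : G, X (a * p)%g = pushforward (ltranslation a) (X p).

Definition left_invariant_metric (g : metric G) :=
  forall (a p : G) u v, tangent p u -> tangent p v ->
    g (a * p)%g (pushforward (ltranslation a) u) (pushforward (ltranslation a) v) = g p u v.

Definition has_lie_algebra (L : vectType R) (br : lie_bracket L) :=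
  exists Lam : {linear L -> vfield G},
    [/\ injective Lam, range Lam = left_invariant_vfield &
        forall x y, Lam (br x y) = bracket (Lam x) (Lam y)].

End LeftInvariance.

(* Main.v *)
(* Up to rotation, the Lie algebra has an orthonormal basis with
   [e1, e2] = a e2 + s e3, [e1, e3] = - s e2 + b e3, [e2, e3] = 0 and
   a b + s^2 <> 0, and the metric has constant curvature - a^2 as soon as
   a = b.  Suppose that a field X spans a conformal foliation by geodesics.
   If X has an e1-component, rescale it to X = e1 + y e2 + z e3.  The
   conditions on the foliation then express the six derivatives of y and z
   along the frame through y, z and two further functions rho and tau (the
   expansion and the rotation of X), and the integrability conditions of this
   system (Riccati's equation) say that the Ricci tensor is a multiple of the
   metric on the plane orthogonal to X.  If a <> b, this leaves only isolated
   directions, so that y and z are constant unless they vanish, and a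
   left-invariant X other than e1 cannot be geodesic since a b + s^2 <> 0;
   finally X = e1 is shear-free only if a = b.  If X is everywhere tangent to
   the ideal <e2, e3>, the first-order conditions already give a = b. *)

Require Import Defs.
From mathcomp Require Import all_boot all_order all_algebra.
From mathcomp Require Import all_classical all_reals all_analysis.
From mathcomp Require Import ring lra.
Import Order.TTheory GRing.Theory Num.Theory.
Import numFieldNormedType.Exports.

Set Implicit Arguments.
Unset Strict Implicit.
Unset Printing Implicit Defensive.

Local Open Scope classical_set_scope.
Local Open Scope ring_scope.

(** * Calculus of iterated differentiability *)

Section IteratedDifferentiability.
Variables (R : realType) (V W : normedModType R).
Implicit Types (O : set V).

(** The vector e1 is the unit normal of the derived algebra, so no bracket has an e1-component.
    Jacobi's identity and the trivial center make the ideal abelian and ad e1 invertible on it: a b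
    + s^2 is the determinant of this restriction, and a, b are the eigenvalues of its symmetric
    part. If a = b, the skew part s merely rotates the ideal and drops out of the curvature; a = 0
    is the flat case. The group only supplies a global orthonormal frame with constant structure
    coefficients; the analysis takes place on any manifold with such a frame. The foliation gives
    five linear equations (two from geodesics, three from conformality) for the six derivatives of
    y, z and one unknown factor, which is why exactly two free functions remain. The trace-free
    symmetric part of Riccati's equation contains no derivative of them and leaves two equations
    between y and z alone. An obstacle is that a connection acts on globally defined fields, whereas
    a generator of the foliation is smooth only locally; the locality of [nabla] in both arguments
    has to be derived from its axioms. *)

Lemma near_eq_differentiable (f h : V -> W) x :
  (\forall y \near x, f y = h y) -> differentiable f x -> differentiable h x.
Proof.
move=> fh df.
have fhx : f x = h x by exact: nbhs_singleton fh.
(* Equal germs have the same first-order expansion, and uniqueness of the differential then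
   transfers everything from f to h. *)
have E : h \o shift x = cst (h x) + 'd f x +o_ 0 id.
  apply/eqaddoP => e e0; have /eqaddoP/(_ e e0) := diff_locally df.
  have fh0 : \forall y \near (0 : V), f (y + x) = h (y + x).
    by rewrite (near_shift 0) /= subr0 in fh.
  apply: filterS2 fh0 => y fhy.
  by rewrite /= !fctE /= fhy fhx.
apply/diff_locallyP; rewrite (diff_unique (diff_continuous df) E).
by split=> //; exact: diff_continuous.
Qed.

Lemma open_near_eq (T : Type) O (f h : V -> T) x : open O -> O x ->
  (forall y, O y -> f y = h y) -> \forall y \near x, f y = h y.
Proof.
by move=> oO Ox fh; apply: filterS (open_nbhs_nbhs (conj oO Ox)) => y /fh.
Qed.

Lemma ndifferentiable_sub k O O' (f : V -> W) :
  O' `<=` O -> ndifferentiable k O f -> ndifferentiable k O' f.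
Proof.
elim: k f => [//|k IH] f sO /= fO x /sO /fO [df dfv]; split=> // v.
exact: IH (dfv v).
Qed.

Lemma ndifferentiable_eq k O (f h : V -> W) : open O ->
  (forall y, O y -> f y = h y) ->
  ndifferentiable k O f -> ndifferentiable k O h.
Proof.
move=> oO; elim: k f h => [//|k IH] f h fh /= fO x Ox.
have [df dfv] := fO x Ox; have near_fh y Oy := open_near_eq oO Oy fh.
split; first by apply: near_eq_differentiable df; exact: near_fh.
by move=> v; apply: IH (dfv v) => y Oy; apply: near_eq_derive; exact: near_fh.
Qed.

(** Used in the product and inverse rules: the derivative of a product still contains the
    undifferentiated factors, which are then needed at the lower order. *)
Lemma ndifferentiable_le k O (f : V -> W) :
  ndifferentiable k.+1 O f -> ndifferentiable k O f.
Proof.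
elim: k f => [//|k IH] f fO x Ox; have [df dfv] := fO x Ox.
by split=> // v; apply: IH; exact: dfv.
Qed.

Lemma ndifferentiable_cst k O (a : W) : ndifferentiable k O (cst a).
Proof.
elim: k a => [//|k IH] a x Ox; split; first exact: differentiable_cst.
move=> v; have -> : (fun y => 'D_v (cst a) y) = cst 0 by apply/funext => y; rewrite derive_cst.
exact: IH.
Qed.

Lemma ndifferentiableD k O (f h : V -> W) : open O ->
  ndifferentiable k O f -> ndifferentiable k O h ->
  ndifferentiable k O (fun x => f x + h x).
Proof.
move=> oO; elim: k f h => [//|k IH] f h fO hO x Ox.
have [df dfv] := fO x Ox; have [dh dhv] := hO x Ox.
split; first exact: differentiableD.
move=> v; apply: ndifferentiable_eq (IH _ _ (dfv v) (dhv v)) => // y Oy.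
have [dfy _] := fO y Oy; have [dhy _] := hO y Oy.
by rewrite [RHS]deriveD //; exact: diff_derivable.
Qed.

End IteratedDifferentiability.

Section IteratedDifferentiabilityR.
Variables (R : realType) (V : normedModType R).
Implicit Types (O : set V) (f h : V -> R).

Lemma ndifferentiableM k O f h : open O ->
  ndifferentiable k O f -> ndifferentiable k O h ->
  ndifferentiable k O (fun x => f x * h x).
Proof.
move=> oO; elim: k f h => [//|k IH] f h fO hO x Ox.
have [df dfv] := fO x Ox; have [dh dhv] := hO x Ox.
split; first exact: differentiableM.
move=> v.
have fO' := ndifferentiable_le fO; have hO' := ndifferentiable_le hO.
apply: ndifferentiable_eq
  (ndifferentiableD oO (IH _ _ fO' (dhv v)) (IH _ _ hO' (dfv v))) => // y Oy.
have [dfy _] := fO y Oy; have [dhy _] := hO y Oy.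
by rewrite [RHS]deriveM //; exact: diff_derivable.
Qed.

Lemma ndifferentiableV k O f : open O -> (forall x, O x -> f x != 0) ->
  ndifferentiable k O f -> ndifferentiable k O (fun x => (f x)^-1).
Proof.
move=> oO f0; elim: k f f0 => [//|k IH] f f0 fO x Ox.
have [df dfv] := fO x Ox.
split; first exact: differentiableV df (f0 x Ox).
move=> v.
have If := IH _ f0 (ndifferentiable_le fO).
have cN : ndifferentiable k O (fun _ : V => -1 : R).
  exact: ndifferentiable_cst.
have NIf := ndifferentiableM oO cN If.
apply: ndifferentiable_eq
  (ndifferentiableM oO (ndifferentiableM oO NIf If) (dfv v)) => // y Oy.
have [dfy _] := fO y Oy.
rewrite [RHS]deriveV ?f0 //; last exact: diff_derivable.
by rewrite /cst /GRing.scale /= expr2 invfM mulN1r !mulNr.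
Qed.

End IteratedDifferentiabilityR.

(** * Functions and tangent vectors in charts *)

Section ManifoldCalculus.
Variables (R : realType) (n : nat) (M : manifoldType R n).
Implicit Types (c d : chart R n M) (p : M) (W : set M) (f h : M -> R).

Lemma chart_mapK c p : atlas c -> chart_dom c p ->
  chart_inv c (chart_map c p) = p.
Proof. by case/atlas_ok => _ _ K _ _ cp; apply: K; rewrite inE. Qed.

Lemma open_chart_image c W : atlas c -> open W ->
  open (chart_map c @` (chart_dom c `&` W)).
Proof.
move=> ac oW; have [_ oim _ _ ci] := atlas_ok c ac.
rewrite openE => _ [p [cp Wp] <-] /=.
have imp : chart_im c (chart_map c p) by exists p.
have nI : nbhs (chart_map c p) (chart_im c) by exact: open_nbhs_nbhs.
have nW : nbhs (chart_map c p) (chart_inv c @^-1` W).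
  rewrite continuous_open_subspace // in ci.
  apply: (ci (chart_map c p)); first by rewrite inE.
  by rewrite chart_mapK //; exact: open_nbhs_nbhs.
apply: filterS2 nI nW => _ [q cq <-] /=; rewrite chart_mapK // => Wq.
by exists q.
Qed.

Lemma open_chart_dom c : atlas c -> open (chart_dom c).
Proof. by case/atlas_ok. Qed.

Lemma smooth_on_sub W W' f : W' `<=` W -> smooth_on W f -> smooth_on W' f.
Proof.
move=> sW sf c ac k; apply: ndifferentiable_sub (sf c ac k).
by apply: image_subset; exact: setIS.
Qed.

Lemma smooth_on_eq W f h : open W -> (forall p, W p -> f p = h p) ->
  smooth_on W f -> smooth_on W h.
Proof.
move=> oW fh sf c ac k; apply: ndifferentiable_eq (sf c ac k).
  exact: open_chart_image.
by move=> _ [p [cp Wp] <-] /=; rewrite chart_mapK // fh.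
Qed.

Lemma smooth_on_cst W (a : R) : smooth_on W (fun=> a).
Proof. by move=> c ac k; exact: ndifferentiable_cst. Qed.

Lemma smooth_onD W f h : open W -> smooth_on W f -> smooth_on W h ->
  smooth_on W (fun p => f p + h p).
Proof.
move=> oW sf sh c ac k.
apply: (ndifferentiableD _ (sf c ac k) (sh c ac k)).
exact: open_chart_image.
Qed.

Lemma smooth_onM W f h : open W -> smooth_on W f -> smooth_on W h ->
  smooth_on W (fun p => f p * h p).
Proof.
move=> oW sf sh c ac k.
apply: (ndifferentiableM _ (sf c ac k) (sh c ac k)).
exact: open_chart_image.
Qed.

Lemma smooth_onN W f : open W -> smooth_on W f -> smooth_on W (fun p => - f p).
Proof.
move=> oW sf; have := smooth_onM oW (smooth_on_cst W (-1)) sf.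
by apply: smooth_on_eq => // p _; rewrite mulN1r.
Qed.

Lemma smooth_onV W f : open W -> (forall p, W p -> f p != 0) ->
  smooth_on W f -> smooth_on W (fun p => (f p)^-1).
Proof.
move=> oW f0 sf c ac k.
apply: (ndifferentiableV _ _ (sf c ac k)); first exact: open_chart_image.
by move=> _ [p [cp Wp] <-] /=; rewrite chart_mapK // f0.
Qed.

Lemma smooth_on_at W f p : open W -> W p -> smooth_on W f -> smooth_at p f.
Proof. by move=> oW Wp sf; exists W. Qed.

Lemma smooth_atD p f h : smooth_at p f -> smooth_at p h ->
  smooth_at p (fun q => f q + h q).
Proof.
move=> [A [oA Ap sf]] [B [oB Bp sh]]; exists (A `&` B).
split; [exact: openI|by []|apply: smooth_onD]; first exact: openI.
  exact: smooth_on_sub sf.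
exact: smooth_on_sub sh.
Qed.

Lemma smooth_atM p f h : smooth_at p f -> smooth_at p h ->
  smooth_at p (fun q => f q * h q).
Proof.
move=> [A [oA Ap sf]] [B [oB Bp sh]]; exists (A `&` B).
split; [exact: openI|by []|apply: smooth_onM]; first exact: openI.
  exact: smooth_on_sub sf.
exact: smooth_on_sub sh.
Qed.

Lemma smooth_at_eq W p f h : open W -> W p -> (forall q, W q -> f q = h q) ->
  smooth_at p f -> smooth_at p h.
Proof.
move=> oW Wp fh [A [oA Ap sf]]; exists (A `&` W).
have oAW : open (A `&` W) by exact: openI.
split=> //; apply: smooth_on_eq (smooth_on_sub (@subIsetl _ A W) sf) => //.
by move=> q [_ /fh].
Qed.

Lemma smooth_at_diff c p f : atlas c -> chart_dom c p -> smooth_at p f ->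
  differentiable (f \o chart_inv c) (chart_map c p).
Proof.
move=> ac cp [W [oW Wp sf]]; have /= H := sf c ac 1%N.
by have [] := H (chart_map c p) (ex_intro2 _ _ p (conj cp Wp) erefl).
Qed.

Lemma chart_near_eq c W p f h : atlas c -> chart_dom c p -> open W -> W p ->
  (forall q, W q -> f q = h q) ->
  \forall z \near chart_map c p, (f \o chart_inv c) z = (h \o chart_inv c) z.
Proof.
move=> ac cp oW Wp fh.
apply: (@open_near_eq _ _ _ (chart_map c @` (chart_dom c `&` W))).
- exact: open_chart_image.
- by exists p.
- by move=> _ [q [cq Wq] <-] /=; rewrite chart_mapK // fh.
Qed.

Definition chart_vec c p (w : 'rV[R]_n) : functional M := fun f =>
  if `[< smooth_at p f >] then 'D_w (f \o chart_inv c) (chart_map c p) else 0.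

Lemma tangent_chart_vec c p w : atlas c -> chart_dom c p ->
  tangent p (chart_vec c p w).
Proof. by move=> ac cp; exists c, w. Qed.

Lemma chart_vec_linear c p (a : R) u v : atlas c -> chart_dom c p ->
  chart_vec c p (a *: u + v) = a *: chart_vec c p u + chart_vec c p v.
Proof.
move=> ac cp; apply/funext => f; rewrite /chart_vec !fctE.
case: asboolP => [sf|_]; last by rewrite scaler0 addr0.
have df := smooth_at_diff ac cp sf.
by rewrite !deriveE // linearP.
Qed.

(** By the chain rule, the direction in the new chart is the image of the old one under the
    differential of the transition map. Working in one fixed chart is what makes the tangent vectors
    at p a vector space. *)
Lemma tangent_in_chart c p v : atlas c -> chart_dom c p -> tangent p v ->
  exists w, v = chart_vec c p w.
Proof.
move=> ac cp [d [w [ad dp vE]]].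
pose phi z := chart_map c (chart_inv d z).
have dphi : differentiable phi (chart_map d p).
  have /= H := atlas_compat d c ad ac 1%N.
  by have [] := H (chart_map d p) (ex_intro2 _ _ p (conj dp cp) erefl).
exists ('d phi (chart_map d p) w); apply/funext => f.
rewrite vE /chart_vec; case: asboolP => // sf.
have phip : phi (chart_map d p) = chart_map c p by rewrite /phi chart_mapK.
have df := smooth_at_diff ac cp sf.
transitivity ('D_w ((f \o chart_inv c) \o phi) (chart_map d p)).
  apply: near_eq_derive.
  apply: (@open_near_eq _ _ _ (chart_map d @` (chart_dom d `&` chart_dom c))).
  - exact: open_chart_image (open_chart_dom _).
  - by exists p.
  - by move=> _ [q [dq cq] <-] /=; rewrite /phi !chart_mapK.
rewrite -phip in df *.
by rewrite deriveE ?diff_comp //= ?deriveE //; exact: differentiable_comp.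
Qed.

Lemma tangent_linear p (a : R) u v : tangent p u -> tangent p v ->
  tangent p (a *: u + v).
Proof.
have [c ac cp] := atlas_cover p.
move=> /(tangent_in_chart ac cp)[wu ->] /(tangent_in_chart ac cp)[wv ->].
by rewrite -chart_vec_linear //; exact: tangent_chart_vec.
Qed.

Section TangentVector.
Variables (p : M) (v : functional M).
Hypothesis tv : tangent p v.

Lemma tangent_cst (a : R) : v (fun=> a) = 0.
Proof.
case: tv => c [w [_ _ ->]]; case: asboolP => // _.
exact: derive_cst.
Qed.

Lemma tangent_eq W f h : open W -> W p -> (forall q, W q -> f q = h q) ->
  v f = v h.
Proof.
move=> oW Wp fh; case: tv => c [w [ac cp vE]]; rewrite !vE.
case: asboolP => sf; case: asboolP => sh //.
- by apply: near_eq_derive; exact: chart_near_eq fh.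
(* Smoothness at p depends on the germ only, so it cannot hold for just one of the two functions. *)
- by case: sh; exact: (smooth_at_eq oW Wp fh).
- by case: sf; apply: (smooth_at_eq oW Wp _ sh) => q Wq; rewrite fh.
Qed.

Lemma tangentD f h : smooth_at p f -> smooth_at p h ->
  v (fun q => f q + h q) = v f + v h.
Proof.
move=> sf sh; case: tv => c [w [ac cp vE]]; rewrite !vE.
rewrite !asboolT //; last exact: smooth_atD.
by rewrite -deriveD; [|exact/diff_derivable/smooth_at_diff..].
Qed.

Lemma tangentM f h : smooth_at p f -> smooth_at p h ->
  v (fun q => f q * h q) = (f p * v h + h p * v f : R).
Proof.
move=> sf sh; case: tv => c [w [ac cp vE]]; rewrite !vE.
rewrite !asboolT //; last exact: smooth_atM.
rewrite [LHS](@deriveM _ _ (f \o chart_inv c) (h \o chart_inv c)) /=;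
  [|exact/diff_derivable/smooth_at_diff..].
by rewrite chart_mapK.
Qed.

End TangentVector.

End ManifoldCalculus.

(** * Orthonormal frames *)

Record orthonormal_frame (R : realType) (M : manifoldType R 3) (g : metric M) :=
  OrthonormalFrame {
  fr1 : vfield M;
  fr2 : vfield M;
  fr3 : vfield M;
  smooth_fr1 : smooth_vfield setT fr1;
  smooth_fr2 : smooth_vfield setT fr2;
  smooth_fr3 : smooth_vfield setT fr3;
  fr11 : forall p, g p (fr1 p) (fr1 p) = 1;
  fr22 : forall p, g p (fr2 p) (fr2 p) = 1;
  fr33 : forall p, g p (fr3 p) (fr3 p) = 1;
  fr12 : forall p, g p (fr1 p) (fr2 p) = 0;
  fr13 : forall p, g p (fr1 p) (fr3 p) = 0;
  fr23 : forall p, g p (fr2 p) (fr3 p) = 0 }.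

Section Frames.
Variables (R : realType) (M : manifoldType R 3) (g : metric M).
Hypothesis rg : riemannian g.
Implicit Types (p : M) (W : set M) (u v w : functional M) (X Y Z : vfield M).

(** Retypes the value from [R^o] to [R], so that derivatives enter ring expressions as ordinary
    numbers. *)
Definition act v (f : M -> R) : R := v f.

Lemma tangent0 p : tangent p (0 : functional M).
Proof.
have [c ac cp] := atlas_cover p.
have t0 := tangent_chart_vec 0 ac cp.
by have := tangent_linear (-1) t0 t0; rewrite scaleN1r addNr.
Qed.

Lemma tangentZ p (x : R) u : tangent p u -> tangent p (x *: u).
Proof.
by move=> tu; have := tangent_linear x tu (tangent0 p); rewrite addr0.
Qed.

Lemma tangentDv p u v : tangent p u -> tangent p v -> tangent p (u + v).
Proof. by move=> tu tv; have := tangent_linear 1 tu tv; rewrite scale1r. Qed.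

Lemma metric_linearl p (x : R) u v w : tangent p u -> tangent p v ->
  tangent p w -> g p (x *: u + v) w = x * g p u w + g p v w.
Proof. by case: rg => lin _ _ _; exact: lin. Qed.

Lemma metricC p u v : tangent p u -> tangent p v -> g p u v = g p v u.
Proof. by case: rg => _ sym _ _; exact: sym. Qed.

Lemma metric0l p w : tangent p w -> g p 0 w = 0.
Proof.
move=> tw; have := metric_linearl 1 (tangent0 p) (tangent0 p) tw.
by rewrite scale1r addr0 mul1r => /eqP; rewrite -subr_eq subrr eq_sym => /eqP.
Qed.

Lemma metricZl p (x : R) u w : tangent p u -> tangent p w ->
  g p (x *: u) w = x * g p u w.
Proof.
move=> tu tw; have := metric_linearl x tu (tangent0 p) tw.
by rewrite addr0 metric0l // addr0.
Qed.

Lemma metricDl p u v w : tangent p u -> tangent p v -> tangent p w ->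
  g p (u + v) w = g p u w + g p v w.
Proof.
by move=> tu tv tw; rewrite -[u]scale1r metric_linearl // mul1r scale1r.
Qed.

Lemma metric_gt0 p u : tangent p u -> u != 0 -> 0 < g p u u.
Proof. by case: rg => _ _ pos _; exact: pos. Qed.

Lemma smooth_metric W X Y : open W -> smooth_vfield W X -> smooth_vfield W Y ->
  smooth_on W (fun p => g p (X p) (Y p)).
Proof. by case: rg => _ _ _; exact. Qed.

Lemma smooth_vfield_sub W W' X :
  W' `<=` W -> smooth_vfield W X -> smooth_vfield W' X.
Proof.
move=> sW [tX dX]; split=> [p /sW /tX //|W2 f oW2 sW2].
by apply: dX => //; exact: subset_trans sW2 sW.
Qed.

Lemma smooth_vfield_eq W X Y : open W -> (forall p, W p -> X p = Y p) ->
  smooth_vfield W X -> smooth_vfield W Y.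
Proof.
move=> oW XY [tX dX]; split=> [p Wp|W' f oW' sW' sf].
  by rewrite -XY //; exact: tX.
by apply: smooth_on_eq (dX W' f oW' sW' sf) => // p /sW' /XY ->.
Qed.

Lemma smooth_vfield_linear W (f : M -> R) X Y : open W -> smooth_on W f ->
  smooth_vfield W X -> smooth_vfield W Y ->
  smooth_vfield W (fun p => f p *: X p + Y p).
Proof.
move=> oW sf [tX dX] [tY dY]; split=> [p Wp|W' h oW' sW' sh].
  by apply: tangent_linear; [exact: tX|exact: tY].
apply: (@smooth_onD _ _ _ W' (fun p => f p * (X p h : R)) (fun p => Y p h)) => //.
  apply: smooth_onM => //; first exact: smooth_on_sub sf.
  exact: dX.
exact: dY.
Qed.

Lemma smooth_vfield0 W : smooth_vfield W (fun=> 0 : functional M).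
Proof.
split=> [p _|W' f oW' _ _]; first exact: tangent0.
exact: smooth_on_cst.
Qed.

Lemma smooth_vfieldZ W (f : M -> R) X : open W -> smooth_on W f ->
  smooth_vfield W X -> smooth_vfield W (fun p => f p *: X p).
Proof.
move=> oW sf sX.
have := smooth_vfield_linear oW sf sX (smooth_vfield0 W).
by apply: smooth_vfield_eq => // p _; rewrite addr0.
Qed.

Lemma smooth_vfieldD W X Y : open W -> smooth_vfield W X -> smooth_vfield W Y ->
  smooth_vfield W (fun p => X p + Y p).
Proof.
move=> oW sX sY.
have := smooth_vfield_linear oW (smooth_on_cst W 1) sX sY.
by apply: smooth_vfield_eq => // p _; rewrite scale1r.
Qed.

Lemma smooth_act W X (f : M -> R) : open W -> smooth_vfield W X ->
  smooth_on W f -> smooth_on W (fun p => act (X p) f).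
Proof. by move=> oW [_ dX] sf; exact: dX. Qed.

Variable e : orthonormal_frame g.
Notation E1 := (fr1 e).
Notation E2 := (fr2 e).
Notation E3 := (fr3 e).

Definition frame_comb p (x y z : R) : functional M :=
  x *: E1 p + (y *: E2 p + z *: E3 p).

Lemma tE1 p : tangent p (E1 p). Proof. by case: (smooth_fr1 e) => + _; exact. Qed.
Lemma tE2 p : tangent p (E2 p). Proof. by case: (smooth_fr2 e) => + _; exact. Qed.
Lemma tE3 p : tangent p (E3 p). Proof. by case: (smooth_fr3 e) => + _; exact. Qed.
Hint Resolve tE1 tE2 tE3 : core.

Lemma tangent_fcomb p x y z : tangent p (frame_comb p x y z).
Proof. by apply: tangent_linear => //; apply: tangent_linear => //; exact: tangentZ. Qed.
Hint Resolve tangent_fcomb : core.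

Lemma act_fcomb p x y z f : act (frame_comb p x y z) f =
  x * act (E1 p) f + (y * act (E2 p) f + z * act (E3 p) f).
Proof. by []. Qed.

Lemma metric_fcombl p x y z w : tangent p w -> g p (frame_comb p x y z) w =
  x * g p (E1 p) w + (y * g p (E2 p) w + z * g p (E3 p) w).
Proof.
move=> tw; rewrite /frame_comb metric_linearl ?metric_linearl ?metricZl //;
  try exact: tangentZ.
by apply: tangent_linear => //; exact: tangentZ.
Qed.

Lemma metric_fcombr p x y z w : tangent p w -> g p w (frame_comb p x y z) =
  x * g p w (E1 p) + (y * g p w (E2 p) + z * g p w (E3 p)).
Proof.
by move=> tw; rewrite metricC // metric_fcombl //; congr (_ * _ + (_ * _ + _ * _));
  rewrite metricC.
Qed.

Lemma metric_fcomb p x y z x' y' z' :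
  g p (frame_comb p x y z) (frame_comb p x' y' z') = x * x' + (y * y' + z * z').
Proof.
have g21 : g p (E2 p) (E1 p) = 0 by rewrite metricC // (fr12, fr13).
have g31 : g p (E3 p) (E1 p) = 0 by rewrite metricC // (fr12, fr13).
have g32 : g p (E3 p) (E2 p) = 0 by rewrite metricC // fr23.
by rewrite metric_fcombl // !metric_fcombr // !(fr11, fr22, fr33, fr12, fr13, fr23) g21 g31 g32; ring.
Qed.

Lemma fcomb_E1 p : frame_comb p 1 0 0 = E1 p.
Proof. by rewrite /frame_comb !scale0r scale1r !addr0. Qed.
Lemma fcomb_E2 p : frame_comb p 0 1 0 = E2 p.
Proof. by rewrite /frame_comb !scale0r scale1r addr0 add0r. Qed.
Lemma fcomb_E3 p : frame_comb p 0 0 1 = E3 p.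
Proof. by rewrite /frame_comb !scale0r scale1r !add0r. Qed.
Lemma fcomb0 p : frame_comb p 0 0 0 = 0.
Proof. by rewrite /frame_comb !scale0r !addr0. Qed.

Lemma fcomb_coef p x y z : [/\ g p (frame_comb p x y z) (E1 p) = x,
  g p (frame_comb p x y z) (E2 p) = y & g p (frame_comb p x y z) (E3 p) = z].
Proof.
by rewrite -{1}fcomb_E1 -{1}fcomb_E2 -{1}fcomb_E3 !metric_fcomb; split; ring.
Qed.

Lemma fcomb_inj p x y z x' y' z' : frame_comb p x y z = frame_comb p x' y' z' ->
  [/\ x = x', y = y' & z = z'].
Proof.
move=> eq_v; have [] := fcomb_coef p x y z; rewrite eq_v.
by have [-> -> ->] := fcomb_coef p x' y' z'.
Qed.

Lemma fcomb_linear p c x y z x' y' z' :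
  c *: frame_comb p x y z + frame_comb p x' y' z' =
  frame_comb p (c * x + x') (c * y + y') (c * z + z').
Proof.
rewrite /frame_comb !scalerDr !scalerA !scalerDl.
by rewrite addrACA; congr (_ + _); rewrite addrACA.
Qed.

Lemma fcombD p x y z x' y' z' :
  frame_comb p x y z + frame_comb p x' y' z' = frame_comb p (x + x') (y + y') (z + z').
Proof. by rewrite -[frame_comb p x y z]scale1r fcomb_linear !mul1r. Qed.

Lemma fcombZ p c x y z :
  c *: frame_comb p x y z = frame_comb p (c * x) (c * y) (c * z).
Proof. by rewrite -[LHS]addr0 -(fcomb0 p) fcomb_linear !addr0. Qed.

Lemma fcombB p x y z x' y' z' :
  frame_comb p x y z - frame_comb p x' y' z' = frame_comb p (x - x') (y - y') (z - z').
Proof. by rewrite -scaleN1r fcombZ fcombD !mulN1r. Qed.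

(* Tangent spaces have dimension at most 3, so that three orthonormal vectors
   span them. *)
Lemma tangent_fcombE p v : tangent p v ->
  v = frame_comb p (g p v (E1 p)) (g p v (E2 p)) (g p v (E3 p)).
Proof.
move=> tv; suff [x [y [z vE]]] : exists x y z, v = frame_comb p x y z.
  by rewrite vE; have [-> -> ->] := fcomb_coef p x y z.
have [c ac cp] := atlas_cover p.
have [w1 e1] := tangent_in_chart ac cp (tE1 p).
have [w2 e2] := tangent_in_chart ac cp (tE2 p).
have [w3 e3] := tangent_in_chart ac cp (tE3 p).
have [w ev] := tangent_in_chart ac cp tv.
pose A : 'M[R]_3 := \matrix_(i < 3)
  (if i == 0 then w1 else if i == 1 then w2 else w3).
have uA (u : 'rV[R]_3) :
    u *m A = u 0 0 *: w1 + (u 0 1 *: w2 + (u 0 2%:R *: w3 + 0)).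
  rewrite mulmx_sum_row !big_ord_recl big_ord0 !rowK /=.
  by congr (_ + (_ + (_ + _))); congr (u _ _ *: _); apply/val_inj.
have cv0 : chart_vec c p 0 = 0.
  have := chart_vec_linear (-1) 0 0 ac cp.
  by rewrite scaler0 addr0 scaleN1r addNr.
have cvE (u : 'rV[R]_3) : chart_vec c p (u *m A) = frame_comb p (u 0 0) (u 0 1) (u 0 2%:R).
  by rewrite uA !chart_vec_linear // cv0 -e1 -e2 -e3 addr0.
(* The metric recovers the coefficients of a combination of the frame, so the three coordinate rows
   are independent and the square matrix A is invertible. *)
have fA : row_free A.
  rewrite -kermx_eq0; apply/rowV0P => u /sub_kermxP uA0.
  have := cvE u; rewrite uA0 cv0 -(fcomb0 p) => /fcomb_inj[u0 u1 u2].
  apply/rowP => i; rewrite mxE.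
  have [->|[->|->]] : i = 0 \/ i = 1 \/ i = 2%:R; last 3 first.
  - exact/esym.
  - exact/esym.
  - exact/esym.
  by case: i => [[|[|[|//]]] li]; [left|right; left|right; right]; exact/val_inj.
have wE : w = (w *m invmx A) *m A by rewrite mulmxKV // -row_free_unit.
by rewrite ev wE cvE; do 3!eexists.
Qed.

End Frames.

(** * The Levi-Civita connection *)

Section LeviCivita.
Variables (R : realType) (M : manifoldType R 3) (g : metric M).
Hypothesis rg : riemannian g.
Variable nabla : connection M.
Hypothesis LC : levi_civita g nabla.
Implicit Types (p : M) (W : set M) (X Y Z : vfield M) (f : M -> R).

Lemma nabla_smooth W X Y : open W -> smooth_vfield W X -> smooth_vfield W Y ->
  smooth_vfield W (nabla X Y).
Proof.
move=> oW sX sY.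
by have [] := LC oW sX sY (smooth_vfield0 W) (smooth_on_cst W 0).
Qed.

Lemma nabla_linearl W f X Y Z p : open W -> smooth_on W f ->
  smooth_vfield W X -> smooth_vfield W Y -> smooth_vfield W Z -> W p ->
  nabla (fun q => f q *: X q + Y q) Z p = f p *: nabla X Z p + nabla Y Z p.
Proof.
by move=> oW sf sX sY sZ Wp; have [_ /(_ p Wp)[]] := LC oW sX sY sZ sf.
Qed.

Lemma nablaDr W X Y Z p : open W ->
  smooth_vfield W X -> smooth_vfield W Y -> smooth_vfield W Z -> W p ->
  nabla X (Y + Z) p = nabla X Y p + nabla X Z p.
Proof.
move=> oW sX sY sZ Wp.
by have [_ /(_ p Wp)[]] := LC oW sX sY sZ (smooth_on_cst W 0).
Qed.

Lemma nablaZr W f X Y p : open W -> smooth_on W f ->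
  smooth_vfield W X -> smooth_vfield W Y -> W p ->
  nabla X (fun q => f q *: Y q) p = f p *: nabla X Y p + act (X p) f *: Y p.
Proof.
by move=> oW sf sX sY Wp; have [_ /(_ p Wp)[]] := LC oW sX sY sY sf.
Qed.

Lemma nabla_torsion W X Y p : open W ->
  smooth_vfield W X -> smooth_vfield W Y -> W p ->
  nabla X Y p - nabla Y X p = bracket X Y p.
Proof.
move=> oW sX sY Wp.
by have [_ /(_ p Wp)[]] := LC oW sX sY sY (smooth_on_cst W 0).
Qed.

Lemma nabla_metric W X Y Z p : open W ->
  smooth_vfield W X -> smooth_vfield W Y -> smooth_vfield W Z -> W p ->
  act (X p) (fun q => g q (Y q) (Z q)) =
  g p (nabla X Y p) (Z p) + g p (Y p) (nabla X Z p).
Proof.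
move=> oW sX sY sZ Wp.
by have [_ /(_ p Wp)[]] := LC oW sX sY sZ (smooth_on_cst W 0).
Qed.

(* Scaling by the smooth function off W does not change a field that vanishes
   on W: hence linearity of nabla over smooth functions forces its locality. *)
Definition off W (q : M) : R := if `[< W q >] then 0 else 1.

Lemma smooth_off W : open W -> smooth_on W (off W).
Proof.
move=> oW; apply: smooth_on_eq (smooth_on_cst W 0) => // p Wp.
by rewrite /off asboolT.
Qed.

Lemma off_scale W Z : (forall q, W q -> Z q = 0) ->
  (fun q => off W q *: Z q) = Z.
Proof.
move=> Z0; apply/funext => q; rewrite /off; case: asboolP => [/Z0 ->|_].
  by rewrite scaler0.
by rewrite scale1r.
Qed.

Lemma smooth_vanishing W Z : open W -> (forall q, W q -> Z q = 0) ->
  smooth_vfield W Z.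
Proof.
move=> oW Z0; apply: smooth_vfield_eq (smooth_vfield0 W) => // q Wq.
by rewrite Z0.
Qed.

Lemma nabla_vanishingl W Z Y p : open W -> (forall q, W q -> Z q = 0) ->
  smooth_vfield W Y -> W p -> nabla Z Y p = 0.
Proof.
move=> oW Z0 sY Wp.
have n00 : nabla (fun=> 0) Y p = 0.
  have lin := nabla_linearl oW (smooth_on_cst W (-1)) (smooth_vfield0 W)
    (smooth_vfield0 W) sY Wp.
  rewrite -[RHS](addNr (nabla (fun=> 0) Y p)) -[in RHS]scaleN1r -lin.
  by congr (nabla _ _ _); apply/funext => q; rewrite scaler0 addr0.
have sZ := smooth_vanishing oW Z0.
have lin := nabla_linearl oW (smooth_off oW) sZ (smooth_vfield0 W) sY Wp.
transitivity (off W p *: nabla Z Y p + nabla (fun=> 0) Y p).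
  rewrite -lin; congr (nabla _ _ _); rewrite -[LHS](off_scale Z0).
  by apply/funext => q; rewrite addr0.
by rewrite n00 addr0 /off asboolT // scale0r.
Qed.

Lemma nabla_vanishingr W X Z p : open W -> (forall q, W q -> Z q = 0) ->
  smooth_vfield W X -> W p -> nabla X Z p = 0.
Proof.
move=> oW Z0 sX Wp; have sZ := smooth_vanishing oW Z0.
have := nablaZr oW (smooth_off oW) sX sZ Wp.
by rewrite off_scale // {1}/off asboolT // scale0r Z0 // scaler0 addr0.
Qed.

Lemma smooth_vfieldB W X Y : open W -> smooth_vfield W X -> smooth_vfield W Y ->
  smooth_vfield W (fun q => X q - Y q).
Proof.
move=> oW sX sY.
have := smooth_vfield_linear oW (smooth_on_cst W (-1)) sY sX.
by apply: smooth_vfield_eq => // q _; rewrite scaleN1r addrC.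
Qed.

(** The differences X - X' and Y - Y' vanish on W, so additivity reduces the claim to vanishing
    fields. This allows a field to be replaced by its frame expansion, which is known on W only. *)
Lemma nabla_eq W X X' Y Y' p : open W ->
  smooth_vfield W X -> smooth_vfield W Y ->
  (forall q, W q -> X q = X' q) -> (forall q, W q -> Y q = Y' q) -> W p ->
  nabla X Y p = nabla X' Y' p.
Proof.
move=> oW sX sY eX eY Wp.
have sX' := smooth_vfield_eq oW eX sX; have sY' := smooth_vfield_eq oW eY sY.
have sXX := smooth_vfieldB oW sX sX'.
have sYY := smooth_vfieldB oW sY sY'.
have -> : X = (fun q => 1 *: (X q - X' q) + X' q).
  by apply/funext => q; rewrite scale1r subrK.
rewrite (nabla_linearl oW (smooth_on_cst W 1) sXX sX' sY Wp).
rewrite (nabla_vanishingl oW _ sY Wp) ?scaler0 ?add0r; last first.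
  by move=> q Wq; rewrite eX // subrr.
have -> : Y = (fun q => Y q - Y' q) + Y'.
  by apply/funext => q; rewrite -[RHS]/(Y q - Y' q + Y' q) subrK.
rewrite (nablaDr oW sX' sYY sY' Wp).
rewrite (nabla_vanishingr oW _ sX' Wp) ?add0r //.
by move=> q Wq; rewrite eY // subrr.
Qed.

(** In Koszul's formula the three derivative terms vanish because the inner products are constant;
    what is left is a linear consequence of three metric and three torsion identities. *)
Lemma koszul X Y Z (k1 k2 k3 : R) p : smooth_vfield setT X ->
  smooth_vfield setT Y -> smooth_vfield setT Z ->
  (forall q, g q (X q) (Y q) = k1) -> (forall q, g q (Y q) (Z q) = k2) ->
  (forall q, g q (Z q) (X q) = k3) ->
  2 * g p (nabla X Y p) (Z p) = g p (bracket X Y p) (Z p)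
    - g p (bracket Y Z p) (X p) + g p (bracket Z X p) (Y p).
Proof.
move=> sX sY sZ cXY cYZ cZX; have oT := @openT M.
have tg A : smooth_vfield setT A -> tangent p (A p) by case=> + _; exact.
have tX := tg _ sX; have tY := tg _ sY; have tZ := tg _ sZ.
have tn A B : smooth_vfield setT A -> smooth_vfield setT B ->
    tangent p (nabla A B p) by move=> sA sB; apply: tg; exact: nabla_smooth.
have cst A B C k : smooth_vfield setT A -> smooth_vfield setT B ->
    smooth_vfield setT C -> (forall q, g q (B q) (C q) = k) ->
    g p (nabla A B p) (C p) + g p (nabla A C p) (B p) = 0.
  move=> sA sB sC cBC; have := nabla_metric oT sA sB sC (I : setT p).
  rewrite (metricC rg (u := B p)); [|exact: tg|exact: tn].
  move=> <-; have -> : (fun q => g q (B q) (C q)) = (fun=> k) by exact/funext.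
  exact/tangent_cst/tg.
have tors A B C : smooth_vfield setT A -> smooth_vfield setT B ->
    smooth_vfield setT C -> g p (bracket A B p) (C p) =
    g p (nabla A B p) (C p) - g p (nabla B A p) (C p).
  move=> sA sB sC; rewrite -(nabla_torsion oT sA sB I) -scaleN1r addrC.
  by rewrite (metric_linearl rg); [ring|exact: tn..|exact: tg].
rewrite !tors //.
have := cst _ _ _ _ sX sY sZ cYZ; have := cst _ _ _ _ sY sZ sX cZX.
have := cst _ _ _ _ sZ sX sY cXY.
lra.
Qed.

End LeviCivita.

(** * Covariant derivatives in a frame with constant structure coefficients *)

Record adapted_frame (R : realType) (M : manifoldType R 3) (g : metric M)
    (a b s : R) := AdaptedFrame {
  aframe :> orthonormal_frame g;
  br12 : forall p, bracket (fr1 aframe) (fr2 aframe) p = frame_comb aframe p 0 a s;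
  br13 : forall p,
    bracket (fr1 aframe) (fr3 aframe) p = frame_comb aframe p 0 (- s) b;
  br23 : forall p, bracket (fr2 aframe) (fr3 aframe) p = 0 }.

Section AdaptedFrame.
Variables (R : realType) (M : manifoldType R 3) (g : metric M).
Hypothesis rg : riemannian g.
Variable nabla : connection M.
Hypothesis LC : levi_civita g nabla.
Variables (a b s : R) (e : adapted_frame g a b s).
Implicit Types (p : M) (W : set M) (X Y Z : vfield M) (f : M -> R).
Notation E1 := (fr1 e).
Notation E2 := (fr2 e).
Notation E3 := (fr3 e).
Notation fcomb := (frame_comb e).
Let sE1 := smooth_fr1 e.
Let sE2 := smooth_fr2 e.
Let sE3 := smooth_fr3 e.
Let oT := @openT M.

Lemma bracketxx X p : bracket X X p = 0.
Proof. by apply/funext => f; rewrite /bracket subrr; case: asboolP. Qed.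

Lemma bracketC X Y p : bracket Y X p = - bracket X Y p.
Proof.
apply/funext => f; rewrite -[RHS]/(- (bracket X Y p f)) /bracket.
by case: asboolP; rewrite ?oppr0 ?opprB.
Qed.

Lemma fcombN p x y z : - fcomb p x y z = fcomb p (- x) (- y) (- z).
Proof. by rewrite -scaleN1r fcombZ !mulN1r. Qed.

Lemma smooth_fcomb W x y z : open W -> smooth_on W x -> smooth_on W y ->
  smooth_on W z -> smooth_vfield W (fun p => fcomb p (x p) (y p) (z p)).
Proof.
move=> oW sx sy sz; have sE i := smooth_vfield_sub (@subsetT _ W) i.
apply: smooth_vfield_linear => //; first exact: sE sE1.
apply: smooth_vfield_linear => //; first exact: sE sE2.
by apply: smooth_vfieldZ => //; exact: sE sE3.
Qed.

Lemma nabla_frame p :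
  (nabla E1 E1 p = 0 /\ nabla E1 E2 p = fcomb p 0 0 s /\
   nabla E1 E3 p = fcomb p 0 (- s) 0) /\
  (nabla E2 E1 p = fcomb p 0 (- a) 0 /\ nabla E2 E2 p = fcomb p a 0 0 /\
   nabla E2 E3 p = 0) /\
  (nabla E3 E1 p = fcomb p 0 0 (- b) /\ nabla E3 E2 p = 0 /\
   nabla E3 E3 p = fcomb p b 0 0).
Proof.
have b21 q : bracket E2 E1 q = fcomb q 0 (- a) (- s).
  by rewrite bracketC br12 fcombN oppr0.
have b31 q : bracket E3 E1 q = fcomb q 0 s (- b).
  by rewrite bracketC br13 fcombN oppr0 opprK.
have b32 q : bracket E3 E2 q = fcomb q 0 0 0.
  by rewrite bracketC br23 oppr0 fcomb0.
have b23 q : bracket E2 E3 q = fcomb q 0 0 0 by rewrite br23 fcomb0.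
have bxx X q : bracket X X q = fcomb q 0 0 0 by rewrite bracketxx fcomb0.
have K X Y k1 k2 k3 k4 k5 k6 k7 : smooth_vfield setT X -> smooth_vfield setT Y ->
    (forall q, g q (X q) (Y q) = k1) ->
    (forall q, g q (Y q) (E1 q) = k2) -> (forall q, g q (E1 q) (X q) = k3) ->
    (forall q, g q (Y q) (E2 q) = k4) -> (forall q, g q (E2 q) (X q) = k5) ->
    (forall q, g q (Y q) (E3 q) = k6) -> (forall q, g q (E3 q) (X q) = k7) ->
    let c Z := 2^-1 * (g p (bracket X Y p) (Z p) - g p (bracket Y Z p) (X p)
      + g p (bracket Z X p) (Y p)) in
    nabla X Y p = fcomb p (c E1) (c E2) (c E3).
  move=> sX sY h1 h2 h3 h4 h5 h6 h7 c.
  have tn : tangent p (nabla X Y p).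
    by have [+ _] := nabla_smooth LC oT sX sY; exact.
  rewrite [LHS](tangent_fcombE rg e tn); congr (frame_comb _ _ _ _ _); rewrite /c.
  - by rewrite -(koszul rg LC p sX sY sE1 h1 h2 h3) mulKf.
  - by rewrite -(koszul rg LC p sX sY sE2 h1 h4 h5) mulKf.
  - by rewrite -(koszul rg LC p sX sY sE3 h1 h6 h7) mulKf.
have [c1 c2 c3] : [/\ forall x y z, g p (fcomb p x y z) (E1 p) = x,
   forall x y z, g p (fcomb p x y z) (E2 p) = y
   & forall x y z, g p (fcomb p x y z) (E3 p) = z].
  by split=> x y z; have [] := fcomb_coef rg e p x y z.
have fin x y z x' y' z' : x = x' -> y = y' -> z = z' ->
  fcomb p x y z = fcomb p x' y' z' by move=> -> -> ->.
(* All nine inner products, in both orders, have to be in the context: [eassumption] selects from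
   them the constants required by [K]. *)
have g1 q : g q (E1 q) (E1 q) = 1 by exact: fr11.
have g2 q : g q (E2 q) (E2 q) = 1 by exact: fr22.
have g3 q : g q (E3 q) (E3 q) = 1 by exact: fr33.
have g4 q : g q (E1 q) (E2 q) = 0 by exact: fr12.
have g5 q : g q (E1 q) (E3 q) = 0 by exact: fr13.
have g6 q : g q (E2 q) (E3 q) = 0 by exact: fr23.
have tE1 := tE1 e; have tE2 := tE2 e; have tE3 := tE3 e.
have g7 q : g q (E2 q) (E1 q) = 0 by rewrite (metricC rg).
have g8 q : g q (E3 q) (E1 q) = 0 by rewrite (metricC rg).
have g9 q : g q (E3 q) (E2 q) = 0 by rewrite (metricC rg).
rewrite -(fcomb0 e p).
split; [|split]; (split; [|split]).
all: etransitivity; [apply: K; eassumption|].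
all: rewrite /= !(bxx, b21, b31, b32, b23, br12, br13) !(c1, c2, c3).
all: apply: fin; lra.
Qed.

Lemma nabla_fcomb W X Y x1 x2 x3 y1 y2 y3 p : open W ->
  smooth_on W x1 -> smooth_on W x2 -> smooth_on W x3 ->
  smooth_on W y1 -> smooth_on W y2 -> smooth_on W y3 ->
  (forall q, W q -> X q = fcomb q (x1 q) (x2 q) (x3 q)) ->
  (forall q, W q -> Y q = fcomb q (y1 q) (y2 q) (y3 q)) -> W p ->
  nabla X Y p = fcomb p
    (act (X p) y1 + (a * x2 p * y2 p + b * x3 p * y3 p))
    (act (X p) y2 - (s * x1 p * y3 p + a * x2 p * y1 p))
    (act (X p) y3 + (s * x1 p * y2 p - b * x3 p * y1 p)).
Proof.
move=> oW sx1 sx2 sx3 sy1 sy2 sy3 eX eY Wp.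
have sW := smooth_vfield_sub (@subsetT _ W).
have sE1' := sW _ sE1; have sE2' := sW _ sE2; have sE3' := sW _ sE3.
have sX' := smooth_fcomb oW sx1 sx2 sx3.
have sY' := smooth_fcomb oW sy1 sy2 sy3.
have sX : smooth_vfield W X by apply: smooth_vfield_eq sX' => // q /eX ->.
have nl A B (f : M -> R) Z := @nabla_linearl _ _ _ _ LC W f A B Z p oW.
have nX Z : smooth_vfield W Z -> nabla X Z p =
    x1 p *: nabla E1 Z p + (x2 p *: nabla E2 Z p + x3 p *: nabla E3 Z p).
  move=> sZ; rewrite (nabla_eq LC oW sX sZ eX (fun _ _ => erefl) Wp).
  rewrite /frame_comb nl //; last first.
    by apply: smooth_vfield_linear => //; exact: smooth_vfieldZ.
  rewrite nl //; last exact: smooth_vfieldZ.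
  congr (_ + (_ + _)).
  (* Linearity is available for fields of the form f X + Y, so the last summand is read as x3 E3 +
     0. *)
  rewrite -[RHS]addr0 -(nabla_vanishingl LC (Z := fun=> 0) oW _ sZ Wp) //.
  rewrite -nl //; last exact: smooth_vfield0.
  by congr (nabla _ _ _); apply/funext => q; rewrite addr0.
have sYE : smooth_vfield W Y by apply: smooth_vfield_eq sY' => // q /eY ->.
rewrite (nabla_eq LC oW sX sYE (fun _ _ => erefl) eY Wp).
have nD A B : smooth_vfield W A -> smooth_vfield W B ->
    nabla X (fun q => A q + B q) p = nabla X A p + nabla X B p.
  by move=> sA sB; exact: (nablaDr LC oW sX sA sB Wp).
rewrite /frame_comb nD; [|exact: smooth_vfieldZ|]; last first.
  by apply: smooth_vfieldD => //; exact: smooth_vfieldZ.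
rewrite nD; [|exact: smooth_vfieldZ..].
rewrite !(nablaZr LC oW) // !nX //.
have [[-> [-> ->]] [[-> [-> ->]] [-> [-> ->]]]] := nabla_frame p.
rewrite -(fcomb_E1 e) -(fcomb_E2 e) -(fcomb_E3 e) -(fcomb0 e p).
rewrite -/(fcomb p _ _ _) !(fcombZ, fcombD).
by congr (frame_comb _ _ _ _ _); ring.
Qed.

End AdaptedFrame.

(** * The direction of the foliation *)

Section Derivations.
Variables (R : realType) (M : manifoldType R 3) (p : M) (v : functional M).
Hypothesis tv : tangent p v.
Implicit Types (f h : M -> R) (d : R).

(** Smoothness and value travel together, so that the derivative of a polynomial expression is
    obtained by composing the rules below as terms. *)
Definition has_act f d := smooth_at p f /\ act v f = d.

Lemma has_act_cst c : has_act (fun=> c) 0.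
Proof.
split; last exact: tangent_cst tv c.
by exists setT; split=> //; [exact: openT|exact: smooth_on_cst].
Qed.

Lemma has_actD f h d d' : has_act f d -> has_act h d' ->
  has_act (fun q => f q + h q) (d + d').
Proof.
move=> [sf <-] [sh <-]; split; first exact: smooth_atD.
by rewrite /act (tangentD tv).
Qed.

Lemma has_actM f h d d' : has_act f d -> has_act h d' ->
  has_act (fun q => f q * h q) (f p * d' + h p * d).
Proof.
move=> [sf <-] [sh <-]; split; first exact: smooth_atM.
by rewrite /act (tangentM tv).
Qed.

Lemma has_actN f d : has_act f d -> has_act (fun q => - f q) (- d).
Proof.
move=> hf; have [sNf aNf] := has_actM (has_act_cst (-1)) hf.
have e q : setT q -> -1 * f q = - f q by rewrite mulN1r.
split; first exact: smooth_at_eq (@openT M) I e sNf.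
by rewrite -[LHS](tangent_eq tv (@openT M) I e) -[RHS]mulN1r -[LHS]/(act v _) aNf mulr0 addr0.
Qed.

Lemma has_act_eq W f h d : open W -> W p -> (forall q, W q -> f q = h q) ->
  has_act f d -> has_act h d.
Proof.
move=> oW Wp fh [sf <-]; split; first exact: smooth_at_eq fh sf.
exact/esym/(tangent_eq tv oW Wp fh).
Qed.

Lemma act_zero W f : open W -> W p -> (forall q, W q -> f q = 0) -> act v f = 0.
Proof.
move=> oW Wp f0; suff [] : has_act f 0 by [].
by apply: (has_act_eq oW Wp _ (has_act_cst 0)) => q /f0.
Qed.

End Derivations.

(** * Integrability conditions of the first-order system *)

Section Commutators.
Variables (R : realType) (M : manifoldType R 3) (g : metric M).
Variables (a b s : R) (e : adapted_frame g a b s).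
Notation E1 := (fr1 e).
Notation E2 := (fr2 e).
Notation E3 := (fr3 e).

Lemma commutators p f : smooth_at p f ->
  [/\ act (E1 p) (fun q => act (E2 q) f) - act (E2 p) (fun q => act (E1 q) f)
      = a * act (E2 p) f + s * act (E3 p) f,
    act (E1 p) (fun q => act (E3 q) f) - act (E3 p) (fun q => act (E1 q) f)
      = b * act (E3 p) f - s * act (E2 p) f &
    act (E2 p) (fun q => act (E3 q) f) - act (E3 p) (fun q => act (E2 q) f) = 0].
Proof.
move=> sf.
have bE X Y : act (X p) (fun q => act (Y q) f) - act (Y p) (fun q => act (X q) f)
    = act (bracket X Y p) f by rewrite /act /bracket asboolT.
rewrite !bE br12 br13 br23 !act_fcomb; split; [ring|ring|by []].
Qed.

(* The integrability conditions of this system do not involve the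
   derivatives of rho and tau: they express that the Ricci tensor is a
   multiple of the metric on the plane orthogonal to (1, y, z). *)
Lemma integrability W (y z rho tau : M -> R) p : open W ->
  smooth_on W y -> smooth_on W z -> smooth_on W rho -> smooth_on W tau ->
  (forall q, W q -> act (E1 q) y = z q * tau q - y q * rho q + s * z q) ->
  (forall q, W q -> act (E2 q) y = rho q + a * (y q * y q) + y q * (z q * tau q) + a) ->
  (forall q, W q -> act (E3 q) y = b * (y q * z q) - tau q * (1 + y q * y q)) ->
  (forall q, W q -> act (E1 q) z = - (y q * tau q) - z q * rho q - s * y q) ->
  (forall q, W q -> act (E2 q) z = tau q * (1 + z q * z q) + a * (y q * z q)) ->
  (forall q, W q -> act (E3 q) z = rho q + b * (z q * z q) - y q * (z q * tau q) + b) ->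
  W p ->
  (a - b) * (b * (1 + z p * z p) + a * (1 + y p * y p)) = 0 /\
  (a - b) * (b * (y p * z p) + s * (1 + y p * y p)) = 0.
Proof.
move=> oW sy sz sr st e1y e2y e3y e1z e2z e3z Wp.
have at_ f : smooth_on W f -> smooth_at p f by exact: smooth_on_at.
have [c12y c13y c23y] := commutators (at_ _ sy).
have [c12z c13z c23z] := commutators (at_ _ sz).
have derE v (tv : tangent p v) (f h : M -> R) (d d' : R) :
    (forall q, W q -> f q = h q) -> has_act p v h d -> d = d' -> act v f = d'.
  move=> fh hd <-.
  by have [] : has_act p v f d by apply: (has_act_eq tv oW Wp _ hd) => q /fh.
pose Y := y p; pose Z := z p; pose r := rho p; pose t := tau p.
(* Leibniz' rule for the six right-hand sides along v. The derivatives of y and z will be replaced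
   by their equations, while those of rho and tau stay unknown. *)
have key v (tv : tangent p v) y1 z1 r1 t1 : act v y = y1 -> act v z = z1 ->
    act v rho = r1 -> act v tau = t1 ->
    [/\ act v (fun q => act (E1 q) y)
          = Z * t1 + t * z1 - (Y * r1 + r * y1) + s * z1,
        act v (fun q => act (E2 q) y)
          = r1 + 2 * a * Y * y1 + (Y * Z * t1 + Y * t * z1 + Z * t * y1) &
        act v (fun q => act (E3 q) y)
          = b * (Y * z1 + Z * y1) - (t1 * (1 + Y * Y) + 2 * t * Y * y1)] /\
    [/\ act v (fun q => act (E1 q) z)
          = - (Y * t1 + t * y1) - (Z * r1 + r * z1) - s * y1,
        act v (fun q => act (E2 q) z)
          = t1 * (1 + Z * Z) + 2 * t * Z * z1 + a * (Y * z1 + Z * y1) &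
        act v (fun q => act (E3 q) z)
          = r1 + 2 * b * Z * z1 - (Y * Z * t1 + Y * t * z1 + Z * t * y1)].
  move=> y1E z1E r1E t1E.
  have hy : has_act p v y y1 by split=> //; exact: at_.
  have hz : has_act p v z z1 by split=> //; exact: at_.
  have hr : has_act p v rho r1 by split=> //; exact: at_.
  have ht : has_act p v tau t1 by split=> //; exact: at_.
  have D f h d d' := @has_actD R M p v tv f h d d'.
  have T f h d d' := @has_actM R M p v tv f h d d'.
  have N f d := @has_actN R M p v tv f d.
  have C c := @has_act_cst R M p v tv c.
  have hyy := T _ _ _ _ hy hy; have hzz := T _ _ _ _ hz hz.
  have hyz := T _ _ _ _ hy hz.
  have hyt := T _ _ _ _ hy ht; have hzt := T _ _ _ _ hz ht.
  have hyr := T _ _ _ _ hy hr; have hzr := T _ _ _ _ hz hr.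
  have hyzt := T _ _ _ _ hy hzt.
  split; split.
  - apply: (derE v tv _ _ _ _ e1y
      (D _ _ _ _ (D _ _ _ _ hzt (N _ _ hyr)) (T _ _ _ _ (C s) hz))).
    rewrite /Y /Z /r /t. ring.
  - apply: (derE v tv _ _ _ _ e2y (D _ _ _ _ (D _ _ _ _
      (D _ _ _ _ hr (T _ _ _ _ (C a) hyy)) hyzt) (C a))).
    rewrite /Y /Z /r /t; ring.
  - apply: (derE v tv _ _ _ _ e3y (D _ _ _ _ (T _ _ _ _ (C b) hyz)
      (N _ _ (T _ _ _ _ ht (D _ _ _ _ (C 1) hyy))))).
    rewrite /Y /Z /r /t; ring.
  - apply: (derE v tv _ _ _ _ e1z (D _ _ _ _ (D _ _ _ _ (N _ _ hyt)
      (N _ _ hzr)) (N _ _ (T _ _ _ _ (C s) hy)))).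
    rewrite /Y /Z /r /t; ring.
  - apply: (derE v tv _ _ _ _ e2z (D _ _ _ _
      (T _ _ _ _ ht (D _ _ _ _ (C 1) hzz)) (T _ _ _ _ (C a) hyz))).
    rewrite /Y /Z /r /t; ring.
  - apply: (derE v tv _ _ _ _ e3z (D _ _ _ _ (D _ _ _ _
      (D _ _ _ _ hr (T _ _ _ _ (C b) hzz)) (N _ _ hyzt)) (C b))).
    rewrite /Y /Z /r /t; ring.
have k1 := key _ (tE1 e p) _ _ _ _ (e1y p Wp) (e1z p Wp) erefl erefl.
have k2 := key _ (tE2 e p) _ _ _ _ (e2y p Wp) (e2z p Wp) erefl erefl.
have k3 := key _ (tE3 e p) _ _ _ _ (e3y p Wp) (e3z p Wp) erefl erefl.
move: k1 k2 k3 => [[_ k12y k13y] [_ k12z k13z]] [[k21y _ k23y] [k21z _ k23z]]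
  [[k31y k32y _] [k31z k32z _]].
rewrite k12y k21y e2y // e3y // in c12y.
rewrite k13y k31y e2y // e3y // in c13y.
rewrite k23y k32y in c23y.
rewrite k12z k21z e2z // e3z // in c12z.
rewrite k13z k31z e2z // e3z // in c13z.
rewrite k23z k32z in c23z.
rewrite -?/Y -?/Z -?/r -?/t in c12y c13y c23y c12z c13z c23z *.
have n0 : 1 + Y * Y + Z * Z != 0.
  by apply: lt0r_neq0; have := sqr_ge0 Y; have := sqr_ge0 Z; rewrite !expr2; lra.
pose K k (L Q : R) (h : L = Q) : k * L = k * Q := congr1 ( *%R k) h.
have S (L Q L' Q' : R) : L = Q -> L' = Q' -> L + L' = Q + Q' by move=> -> ->.
have F (X L Q : R) : L = Q -> 2 * (1 + Y * Y + Z * Z) * X = Q - L -> X = 0.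
  by move=> -> /eqP; rewrite subrr !mulf_eq0 (negPf n0) pnatr_eq0 /= => /eqP ->.
(* With X = (1, y, z), H2 = (-y, 1, 0) and H3 = (-z, 0, 1), the triples (uy, yz, -Z) and (yz, uz, Y)
   are the coordinates of the bivectors X /\ H2 and X /\ H3. They turn the commutator identities
   into those along X and H2, or X and H3. The outer weights are entries of the Gram matrix of H2,
   H3; they extract the trace-free symmetric part, where the derivatives of rho and tau cancel. The
   common factor is twice the squared length of X. *)
pose uy := 1 + Y * Y; pose uz := 1 + Z * Z; pose yz := Y * Z.
split.
- apply: (F _ _ _ (S _ _ _ _
    (K (2 * uz) _ _ (S _ _ _ _ (K uy _ _ c12y) (S _ _ _ _ (K yz _ _ c13y) (K (- Z) _ _ c23y))))
    (K (- 2 * uy) _ _ (S _ _ _ _ (K yz _ _ c12z) (S _ _ _ _ (K uz _ _ c13z) (K Y _ _ c23z)))))).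
  rewrite /uy /uz /yz; ring.
- apply: (F _ _ _ (S _ _ _ _ (K (- uy) _ _ (S _ _ _ _
      (S _ _ _ _ (K uy _ _ c12z) (S _ _ _ _ (K yz _ _ c13z) (K (- Z) _ _ c23z)))
      (S _ _ _ _ (K yz _ _ c12y) (S _ _ _ _ (K uz _ _ c13y) (K Y _ _ c23y)))))
    (K (2 * yz) _ _ (S _ _ _ _ (K uy _ _ c12y) (S _ _ _ _ (K yz _ _ c13y) (K (- Z) _ _ c23y)))))).
  rewrite /uy /uz /yz; ring.
Qed.
End Commutators.

(** * From the first-order equations to a = b *)

Section DirectionEquations.
Variables (R : realType) (M : manifoldType R 3) (g : metric M).
Variables (a b s : R) (e : adapted_frame g a b s).
Hypothesis det : a * b + s * s != 0.
Notation E1 := (fr1 e).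
Notation E2 := (fr2 e).
Notation E3 := (fr3 e).

Lemma transverse_direction W (y z rho tau : M -> R) p : open W -> W p ->
  smooth_on W y -> smooth_on W z -> smooth_on W rho -> smooth_on W tau ->
  (forall q, W q -> act (E1 q) y = z q * tau q - y q * rho q + s * z q) ->
  (forall q, W q -> act (E2 q) y = rho q + a * (y q * y q) + y q * (z q * tau q) + a) ->
  (forall q, W q -> act (E3 q) y = b * (y q * z q) - tau q * (1 + y q * y q)) ->
  (forall q, W q -> act (E1 q) z = - (y q * tau q) - z q * rho q - s * y q) ->
  (forall q, W q -> act (E2 q) z = tau q * (1 + z q * z q) + a * (y q * z q)) ->
  (forall q, W q -> act (E3 q) z = rho q + b * (z q * z q) - y q * (z q * tau q) + b) ->
  a = b.
Proof.
move=> oW Wp sy sz sr st e1y e2y e3y e1z e2z e3z.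
apply/eqP; apply: contraT => ab.
have abI x : (a - b) * x = 0 -> x = 0.
  by move=> /eqP; rewrite mulf_eq0 subr_eq0 (negPf ab) => /eqP.
have G q : W q -> b * (1 + z q * z q) + a * (1 + y q * y q) = 0 /\
    b * (y q * z q) + s * (1 + y q * y q) = 0.
  move=> Wq.
  have [] := integrability oW sy sz sr st e1y e2y e3y e1z e2z e3z Wq.
  by move=> /abI ? /abI.
have pos (x : R) : 0 < 1 + x * x by have := sqr_ge0 x; rewrite expr2; lra.
have b0 : b != 0.
  apply/eqP => b0; have [] := G p Wp; rewrite b0 !mul0r !add0r.
  have u0 : 1 + y p * y p != 0 by rewrite lt0r_neq0.
  move=> /eqP; rewrite mulf_eq0 (negPf u0) orbF => /eqP a0.
  move=> /eqP; rewrite mulf_eq0 (negPf u0) orbF => /eqP s0.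
  by move: det; rewrite a0 s0 !mul0r addr0 eqxx.
(* The two algebraic equations hold on an open set and can be differentiated: this gives a
   homogeneous linear system for the derivatives of y and z in each direction. *)
have dG q v : W q -> tangent q v ->
    b * z q * act v z + a * y q * act v y = 0 /\
    b * (y q * act v z + z q * act v y) + 2 * s * y q * act v y = 0.
  move=> Wq tv.
  have hy : has_act q v y (act v y) by split=> //; exact: smooth_on_at sy.
  have hz : has_act q v z (act v z) by split=> //; exact: smooth_on_at sz.
  have D f h d d' := @has_actD R M q v tv f h d d'.
  have T f h d d' := @has_actM R M q v tv f h d d'.
  have C c := @has_act_cst R M q v tv c.
  have oy := D _ _ _ _ (C 1) (T _ _ _ _ hy hy).
  have oz := D _ _ _ _ (C 1) (T _ _ _ _ hz hz).
  have [_ h1] := D _ _ _ _ (T _ _ _ _ (C b) oz) (T _ _ _ _ (C a) oy).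
  have [_ h2] := D _ _ _ _ (T _ _ _ _ (C b) (T _ _ _ _ hy hz)) (T _ _ _ _ (C s) oy).
  rewrite (act_zero tv oW Wq) in h1; last by move=> w /G[].
  rewrite (act_zero tv oW Wq) in h2; last by move=> w /G[].
  split; last by rewrite [RHS]h2; ring.
  have two (x : R) : x + x = 0 -> x = 0 by lra.
  by apply: two; rewrite [RHS]h1; ring.
have yz0 q : W q -> y q = 0 /\ z q = 0.
  move=> Wq; have [G1 G2] := G q Wq.
  suff /eqP : y q * y q + z q * z q = 0.
    rewrite -!expr2 paddr_eq0 ?sqr_ge0 // !sqrf_eq0.
    by case/andP => /eqP-> /eqP->.
  apply/eqP; apply: contraT => nz.
  (* D is the determinant of that system. Modulo the two algebraic equations, D (1 + y^2) = - b^2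
     (y^2 + z^2), so D is nonzero away from y = z = 0. *)
  pose D := a * b * (y q * y q) - b * b * (z q * z q) - 2 * s * b * (y q * z q).
  have D0 : D != 0.
    have : D * (1 + y q * y q) != 0.
      have -> : D * (1 + y q * y q) = - (b * b) * (y q * y q + z q * z q)
        + (b * (y q * y q) * (b * (1 + z q * z q) + a * (1 + y q * y q))
        - 2 * b * (y q * z q) * (b * (y q * z q) + s * (1 + y q * y q))).
        by rewrite /D; ring.
      rewrite G1 G2 !mulr0 subrr addr0 mulf_eq0 (negPf nz) orbF oppr_eq0.
      by rewrite mulf_eq0 (negPf b0).
    by rewrite mulf_eq0 negb_or => /andP[].
  have DI x : D * x = 0 -> x = 0 by move=> /eqP; rewrite mulf_eq0 (negPf D0) => /eqP.
  have dyz v : tangent q v -> act v y = 0 /\ act v z = 0.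
    move=> tv; have [h1 h2] := dG q v Wq tv; split; apply: DI.
      transitivity (b * y q * (b * z q * act v z + a * y q * act v y)
        - b * z q * (b * (y q * act v z + z q * act v y) + 2 * s * y q * act v y)).
        by rewrite /D; ring.
      by rewrite h1 h2 !mulr0 subrr.
    transitivity (a * y q * (b * (y q * act v z + z q * act v y) + 2 * s * y q * act v y)
        - (b * z q + 2 * s * y q) * (b * z q * act v z + a * y q * act v y)).
      by rewrite /D; ring.
    by rewrite h1 h2 !mulr0 subrr.
  have [y1 z1] := dyz _ (tE1 e q); have [y2 z2] := dyz _ (tE2 e q).
  have [y3 z3] := dyz _ (tE3 e q).
  rewrite e1y // in y1; rewrite e1z // in z1; rewrite e2y // in y2.
  rewrite e2z // in z2; rewrite e3y // in y3; rewrite e3z // in z3.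
  (* The sums below are the derivatives of y and z along X, from which rho and tau cancel. They
     express that the covariant derivative of X along itself is m X. Pairing them with (y, z) gives
     m (1 + y^2 + z^2) = 0, and then (y, z) solves a linear system of determinant a b + s^2. *)
  pose m := a * (y q * y q) + b * (z q * z q).
  have gy : s * z q + a * y q + m * y q = 0.
    transitivity ((z q * tau q - y q * rho q + s * z q)
      + y q * (rho q + a * (y q * y q) + y q * (z q * tau q) + a)
      + z q * (b * (y q * z q) - tau q * (1 + y q * y q))); first by rewrite /m; ring.
    by rewrite y1 y2 y3 !mulr0 !addr0.
  have gz : - (s * y q) + b * z q + m * z q = 0.
    transitivity ((- (y q * tau q) - z q * rho q - s * y q)
      + y q * (tau q * (1 + z q * z q) + a * (y q * z q))
      + z q * (rho q + b * (z q * z q) - y q * (z q * tau q) + b)); first by rewrite /m; ring.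
    by rewrite z1 z2 z3 !mulr0 !addr0.
  have m0 : m = 0.
    have /eqP : m * (1 + y q * y q + z q * z q) = 0.
      transitivity (y q * (s * z q + a * y q + m * y q)
        + z q * (- (s * y q) + b * z q + m * z q)); first by rewrite /m; ring.
      by rewrite gy gz !mulr0 addr0.
    rewrite mulf_eq0 => /orP[/eqP //|/eqP].
    by have := sqr_ge0 (y q); have := sqr_ge0 (z q); rewrite !expr2; lra.
  rewrite m0 !mul0r !addr0 in gy gz.
  have dI x : (a * b + s * s) * x = 0 -> x = 0.
    by move=> /eqP; rewrite mulf_eq0 (negPf det) => /eqP.
  have y0 : y q = 0.
    apply: dI; transitivity (b * (s * z q + a * y q) - s * (- (s * y q) + b * z q)).
      by ring.
    by rewrite gy gz !mulr0 subrr.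
  have z0 : z q = 0.
    apply: dI; transitivity (s * (s * z q + a * y q) + a * (- (s * y q) + b * z q)).
      by ring.
    by rewrite gy gz !mulr0 addr0.
  by rewrite y0 z0 !mulr0 addr0 eqxx in nz.
(* Now y = z = 0 on all of W, and the equations for E2 y and E3 z become rho + a = 0 and rho + b =
   0. *)
have d2 := act_zero (tE2 e p) oW Wp (fun q Wq => (yz0 q Wq).1).
have d3 := act_zero (tE3 e p) oW Wp (fun q Wq => (yz0 q Wq).2).
have [y0 z0] := yz0 p Wp.
rewrite e2y // y0 in d2; rewrite e3z // z0 in d3.
by move: ab; rewrite (_ : a = b) ?eqxx //; lra.
Qed.

(** Differentiating a + b z^2 = 0 along e1 gives b z (E1 z) = 0. If b is nonzero, each of the other
    two cases leads to E1 z = 0 at p, and both equations then say [e1, e2 + z e3] = 0 with z frozen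
    at p, which contradicts the invertibility of ad e1 on the ideal. *)
Lemma ideal_direction W (z : M -> R) p : open W -> W p -> smooth_on W z ->
  (forall q, W q -> a + b * (z q * z q) = 0) ->
  act (E1 p) z + s * (1 + z p * z p) + (b - a) * z p = 0 ->
  a = b.
Proof.
move=> oW Wp sz az e1z; have azp := az p Wp.
have tv := tE1 e p.
have hz : has_act p (E1 p) z (act (E1 p) z) by split=> //; exact: smooth_on_at sz.
have [_ h] := has_actD tv (has_act_cst tv a)
  (has_actM tv (has_act_cst tv b) (has_actM tv hz hz)).
rewrite (act_zero tv oW Wp) // in h.
have bz : b * z p * act (E1 p) z = 0.
  have two (x : R) : x + x = 0 -> x = 0 by lra.
  by apply: two; rewrite [RHS]h; ring.
have u0 : 1 + z p * z p != 0.
  by apply: lt0r_neq0; have := sqr_ge0 (z p); rewrite expr2; lra.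
move/eqP: bz; rewrite !mulf_eq0 -orbA => /or3P[/eqP b0|/eqP z0|/eqP d0].
- by rewrite b0 mul0r addr0 in azp; rewrite azp b0.
- rewrite z0 !mulr0 addr0 in azp.
  have [-> //|b0] := eqVneq b 0.
  have zW q : W q -> z q = 0.
    move=> Wq; have := az q Wq; rewrite azp add0r => /eqP.
    by rewrite !mulf_eq0 (negPf b0) orbb => /eqP.
  rewrite (act_zero tv oW Wp zW) z0 !mulr0 !addr0 add0r mulr1 in e1z.
  by move: det; rewrite azp e1z !mul0r addr0 eqxx.
- rewrite d0 add0r in e1z.
  have aE : a = - (b * (z p * z p)) by lra.
  have sE : s = - (b * z p).
    apply: (mulIf u0); apply/eqP; rewrite -subr_eq0 -[X in _ == X]e1z aE.
    by apply/eqP; ring.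
  by case/eqP: det; rewrite sE aE; ring.
Qed.

End DirectionEquations.

(** * Curvature *)

Section ConstantCurvature.
Variables (R : realType) (M : manifoldType R 3) (g : metric M).
Hypothesis rg : riemannian g.
Variable nabla : connection M.
Hypothesis LC : levi_civita g nabla.
Variables (a s : R) (e : adapted_frame g a a s).
Notation E1 := (fr1 e).
Notation E2 := (fr2 e).
Notation E3 := (fr3 e).
Notation fcomb := (frame_comb e).

(** The computation keeps variable coefficients instead of passing through tensoriality. All their
    derivatives cancel, and so does s, whose part of ad e1 is skew. *)
Lemma curvature_fcomb W X Y x1 x2 x3 y1 y2 y3 p : open W ->
  smooth_on W x1 -> smooth_on W x2 -> smooth_on W x3 ->
  smooth_on W y1 -> smooth_on W y2 -> smooth_on W y3 ->
  (forall q, W q -> X q = fcomb q (x1 q) (x2 q) (x3 q)) ->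
  (forall q, W q -> Y q = fcomb q (y1 q) (y2 q) (y3 q)) -> W p ->
  let xy := x1 p * y1 p + x2 p * y2 p + x3 p * y3 p in
  let yy := y1 p * y1 p + y2 p * y2 p + y3 p * y3 p in
  curvature nabla X Y Y p = fcomb p
    (- a ^+ 2 * (yy * x1 p - xy * y1 p))
    (- a ^+ 2 * (yy * x2 p - xy * y2 p))
    (- a ^+ 2 * (yy * x3 p - xy * y3 p)).
Proof.
move=> oW sx1 sx2 sx3 sy1 sy2 sy3 eX eY Wp xy yy.
have sX : smooth_vfield W X.
  by apply: smooth_vfield_eq (smooth_fcomb e oW sx1 sx2 sx3) => // q /eX ->.
have sY : smooth_vfield W Y.
  by apply: smooth_vfield_eq (smooth_fcomb e oW sy1 sy2 sy3) => // q /eY ->.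
have [tX _] := sX; have [tY _] := sY.
have nXY q := nabla_fcomb rg LC oW sx1 sx2 sx3 sy1 sy2 sy3 eX eY (p := q).
have nYX q := nabla_fcomb rg LC oW sy1 sy2 sy3 sx1 sx2 sx3 eY eX (p := q).
have nYY q := nabla_fcomb rg LC oW sy1 sy2 sy3 sy1 sy2 sy3 eY eY (p := q).
have sD f h := @smooth_onD _ _ _ W f h oW.
have sM f h := @smooth_onM _ _ _ W f h oW.
have sN f := @smooth_onN _ _ _ W f oW.
have sC c := @smooth_on_cst _ _ M W c.
have sAX f : smooth_on W f -> smooth_on W (fun q => act (X q) f).
  exact: smooth_act.
have sAY f : smooth_on W f -> smooth_on W (fun q => act (Y q) f).
  exact: smooth_act.
have sn1 (u2 u3 v2 v3 h : M -> R) : smooth_on W u2 -> smooth_on W u3 ->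
    smooth_on W v2 -> smooth_on W v3 -> smooth_on W h ->
    smooth_on W (fun q => h q + (a * u2 q * v2 q + a * u3 q * v3 q)).
  move=> s2 s3 t2 t3 sh.
  exact: (sD _ _ sh (sD _ _ (sM _ _ (sM _ _ (sC a) s2) t2)
                            (sM _ _ (sM _ _ (sC a) s3) t3))).
have sn2 (u1 u2 v1 v3 h : M -> R) : smooth_on W u1 -> smooth_on W u2 ->
    smooth_on W v1 -> smooth_on W v3 -> smooth_on W h ->
    smooth_on W (fun q => h q - (s * u1 q * v3 q + a * u2 q * v1 q)).
  move=> s1 s2 t1 t3 sh.
  exact: (sD _ _ sh (sN _ (sD _ _ (sM _ _ (sM _ _ (sC s) s1) t3)
                                  (sM _ _ (sM _ _ (sC a) s2) t1)))).
have sn3 (u1 u3 v1 v2 h : M -> R) : smooth_on W u1 -> smooth_on W u3 ->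
    smooth_on W v1 -> smooth_on W v2 -> smooth_on W h ->
    smooth_on W (fun q => h q + (s * u1 q * v2 q - a * u3 q * v1 q)).
  move=> s1 s3 t1 t2 sh.
  exact: (sD _ _ sh (sD _ _ (sM _ _ (sM _ _ (sC s) s1) t2)
                            (sN _ (sM _ _ (sM _ _ (sC a) s3) t1)))).
have at_ f : smooth_on W f -> smooth_at p f by exact: smooth_on_at.
have der1 v (tv : tangent p v) (u2 u3 v2 v3 h : M -> R) : smooth_on W u2 ->
    smooth_on W u3 -> smooth_on W v2 -> smooth_on W v3 -> smooth_on W h ->
    act v (fun q => h q + (a * u2 q * v2 q + a * u3 q * v3 q)) =
    act v h + (a * (act v u2 * v2 p + u2 p * act v v2)
             + a * (act v u3 * v3 p + u3 p * act v v3)).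
  move=> /at_ s1 /at_ s2 /at_ s3 /at_ s4 /at_ s5.
  have T f h' sf sh := @has_actM _ _ p v tv f h' _ _ (conj sf erefl) (conj sh erefl).
  have C := has_act_cst tv a.
  have [_ ->] := has_actD tv (conj s5 erefl) (has_actD tv
    (has_actM tv (has_actM tv C (conj s1 erefl)) (conj s3 erefl))
    (has_actM tv (has_actM tv C (conj s2 erefl)) (conj s4 erefl))).
  by ring.
have der2 v (tv : tangent p v) (u1 u2 v1 v3 h : M -> R) : smooth_on W u1 ->
    smooth_on W u2 -> smooth_on W v1 -> smooth_on W v3 -> smooth_on W h ->
    act v (fun q => h q - (s * u1 q * v3 q + a * u2 q * v1 q)) =
    act v h - (s * (act v u1 * v3 p + u1 p * act v v3)
             + a * (act v u2 * v1 p + u2 p * act v v1)).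
  move=> /at_ s1 /at_ s2 /at_ s3 /at_ s4 /at_ s5.
  have [_ ->] := has_actD tv (conj s5 erefl) (has_actN tv (has_actD tv
    (has_actM tv (has_actM tv (has_act_cst tv s) (conj s1 erefl)) (conj s4 erefl))
    (has_actM tv (has_actM tv (has_act_cst tv a) (conj s2 erefl)) (conj s3 erefl)))).
  by ring.
have der3 v (tv : tangent p v) (u1 u3 v1 v2 h : M -> R) : smooth_on W u1 ->
    smooth_on W u3 -> smooth_on W v1 -> smooth_on W v2 -> smooth_on W h ->
    act v (fun q => h q + (s * u1 q * v2 q - a * u3 q * v1 q)) =
    act v h + (s * (act v u1 * v2 p + u1 p * act v v2)
             - a * (act v u3 * v1 p + u3 p * act v v1)).
  move=> /at_ s1 /at_ s2 /at_ s3 /at_ s4 /at_ s5.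
  have [_ ->] := has_actD tv (conj s5 erefl) (has_actD tv
    (has_actM tv (has_actM tv (has_act_cst tv s) (conj s1 erefl)) (conj s4 erefl))
    (has_actN tv
    (has_actM tv (has_actM tv (has_act_cst tv a) (conj s2 erefl)) (conj s3 erefl)))).
  by ring.
have nXYs := (sn1 _ _ _ _ _ sx2 sx3 sy2 sy3 (sAX _ sy1),
  sn2 _ _ _ _ _ sx1 sx2 sy1 sy3 (sAX _ sy2), sn3 _ _ _ _ _ sx1 sx3 sy1 sy2 (sAX _ sy3)).
have nYXs := (sn1 _ _ _ _ _ sy2 sy3 sx2 sx3 (sAY _ sx1),
  sn2 _ _ _ _ _ sy1 sy2 sx1 sx3 (sAY _ sx2), sn3 _ _ _ _ _ sy1 sy3 sx1 sx2 (sAY _ sx3)).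
have nYYs := (sn1 _ _ _ _ _ sy2 sy3 sy2 sy3 (sAY _ sy1),
  sn2 _ _ _ _ _ sy1 sy2 sy1 sy3 (sAY _ sy2), sn3 _ _ _ _ _ sy1 sy3 sy1 sy2 (sAY _ sy3)).
have brE q : W q -> bracket X Y q = nabla X Y q - nabla Y X q.
  by move=> Wq; rewrite (nabla_torsion LC oW sX sY Wq).
have brA f : smooth_on W f -> act (bracket X Y p) f =
    act (X p) (fun q => act (Y q) f) - act (Y p) (fun q => act (X q) f).
  by move=> sf; rewrite /act /bracket asboolT //; exact: at_.
have sNN f h : smooth_on W f -> smooth_on W h -> smooth_on W (fun q => f q - h q).
  by move=> sf sh; apply: sD => //; exact: sN.
(* Torsion-freeness expands the bracket in the frame on all of W, as [nabla_fcomb] requires. Its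
   action on the coefficients of Y is computed by [brA], which provides the second derivatives to be
   cancelled. *)
have brE' q (Wq : W q) := etrans (etrans (brE q Wq)
  (congr2 (fun u v => u - v) (nXY q Wq) (nYX q Wq))) (fcombB e q _ _ _ _ _ _).
have bE := nabla_fcomb rg LC oW (sNN _ _ nXYs.1.1 nYXs.1.1)
  (sNN _ _ nXYs.1.2 nYXs.1.2) (sNN _ _ nXYs.2 nYXs.2) sy1 sy2 sy3 brE' eY Wp.
rewrite /curvature.
rewrite -[LHS]/(nabla X (nabla Y Y) p - nabla Y (nabla X Y) p - nabla (bracket X Y) Y p).
rewrite bE (nabla_fcomb rg LC oW sx1 sx2 sx3 nYYs.1.1 nYYs.1.2 nYYs.2 eX nYY Wp).
rewrite (nabla_fcomb rg LC oW sy1 sy2 sy3 nXYs.1.1 nXYs.1.2 nXYs.2 eY nXY Wp).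
rewrite !brA // !fcombB.
rewrite !(der1, der2, der3) //; try solve [exact: tX|exact: tY|exact: sAX|exact: sAY].
by congr (frame_comb _ _ _ _ _); rewrite /xy /yy; ring.
Qed.

Lemma constant_curvature : constant_sectional_curvature g nabla.
Proof.
exists (- a ^+ 2) => W X Y p oW sX sY Wp indep.
have [tX _] := sX; have [tY _] := sY.
have sW := smooth_vfield_sub (@subsetT _ W).
have sc A B : smooth_vfield W A -> smooth_vfield setT B ->
    smooth_on W (fun q => g q (A q) (B q)).
  by move=> sA sB; apply: (smooth_metric rg) => //; exact: sW.
have XE q (Wq : W q) := tangent_fcombE rg e (tX q Wq).
have YE q (Wq : W q) := tangent_fcombE rg e (tY q Wq).
rewrite /sectional (curvature_fcomb oW (sc _ _ sX (smooth_fr1 e))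
  (sc _ _ sX (smooth_fr2 e)) (sc _ _ sX (smooth_fr3 e))
  (sc _ _ sY (smooth_fr1 e)) (sc _ _ sY (smooth_fr2 e))
  (sc _ _ sY (smooth_fr3 e)) XE YE Wp).
set x1 := g p (X p) (E1 p); set x2 := g p (X p) (E2 p).
set x3 := g p (X p) (E3 p); set y1 := g p (Y p) (E1 p).
set y2 := g p (Y p) (E2 p); set y3 := g p (Y p) (E3 p).
have Xp : X p = fcomb p x1 x2 x3 by exact: XE.
have Yp : Y p = fcomb p y1 y2 y3 by exact: YE.
rewrite Xp Yp !(metric_fcomb rg).
set D := _ - _ ^+ 2; suff D0 : D != 0.
  by apply: (mulIf D0); rewrite divfK // /D; ring.
pose xy := x1 * y1 + x2 * y2 + x3 * y3.
pose yy := y1 * y1 + y2 * y2 + y3 * y3.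
apply/eqP => D0.
have sq0 (u v w : R) : u * u + v * v + w * w = 0 -> [/\ u = 0, v = 0 & w = 0].
  move/eqP; rewrite -!expr2 paddr_eq0 ?addr_ge0 ?sqr_ge0 // paddr_eq0 ?sqr_ge0 //.
  by rewrite !sqrf_eq0 => /andP[/andP[/eqP-> /eqP->] /eqP->].
(* The vector yy X - xy Y has squared length yy D. If the Gram determinant D is zero, it is a
   trivial combination, so yy = 0 and Y vanishes at p. *)
have [v1 v2 v3] : [/\ yy * x1 + - xy * y1 = 0, yy * x2 + - xy * y2 = 0 &
    yy * x3 + - xy * y3 = 0].
  apply: sq0; transitivity (yy * D); last by rewrite D0 mulr0.
  by rewrite /D /yy /xy; ring.
have [yy0 _] : yy = 0 /\ - xy = 0.
  by apply: indep; rewrite Xp Yp !fcombZ fcombD v1 v2 v3 fcomb0.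
have [y10 y20 y30] := sq0 _ _ _ yy0.
have [_ /eqP] : (0 : R) = 0 /\ (1 : R) = 0.
  by apply: indep; rewrite Yp y10 y20 y30 fcomb0 scale0r scaler0 addr0.
by rewrite oner_eq0.
Qed.

End ConstantCurvature.

(** * Foliations *)

Section LineFields.
Variables (R : realType) (M : manifoldType R 3) (g : metric M).
Hypothesis rg : riemannian g.
Variable nabla : connection M.
Hypothesis LC : levi_civita g nabla.
Variables (U : set M) (V : subbundle M).
Implicit Types (p q : M) (W : set M) (X Y Z : vfield M).

Definition spans W X := forall q, W q ->
  X q != 0 /\ V q = [set v | exists k : R, v = k *: X q].

Lemma line_generator p : Defs.distribution 1 U V -> U p -> exists W X,
  [/\ open W, W p, W `<=` U, smooth_vfield W X & spans W X].
Proof.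
move=> dV Up; have [W [X [oW Wp WU sX XV]]] := dV p Up.
exists W, (X ord0); split=> // q /XV[ind ->]; split.
  apply/eqP => X0; have := ind (fun=> (1 : R)); rewrite big_ord1 X0 scaler0.
  by move=> /(_ erefl ord0)/eqP; rewrite oner_eq0.
apply/seteqP; split=> v [k ->]; first by exists (k ord0); rewrite big_ord1.
by exists (fun=> k); rewrite big_ord1.
Qed.

Lemma spans_scale W W' X (f : M -> R) : W' `<=` W ->
  (forall q, W' q -> f q != 0) -> spans W X -> spans W' (fun q => f q *: X q).
Proof.
move=> sW f0 XV q W'q; have [X0 ->] := XV q (sW q W'q).
split; first by rewrite scaler_eq0 negb_or f0.
apply/seteqP; split=> v [k ->].
  by exists (k / f q); rewrite scalerA divfK // f0.
by exists (k * f q); rewrite scalerA.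
Qed.

(** [oproj] is a choice with default value 0, so that even its vanishing says something only once a
    projection has been exhibited. *)
Lemma oprojP (D : subbundle M) p v :
  (exists w, D p w /\ forall u, D p u -> g p (v - w) u = 0) ->
  D p (oproj g D p v) /\ forall u, D p u -> g p (v - oproj g D p v) u = 0.
Proof. exact: xgetPex. Qed.

Section Generator.
Variables (W : set M) (X : vfield M).
Hypotheses (oW : open W) (WU : W `<=` U) (sX : smooth_vfield W X)
  (XV : spans W X).

Let tX q : W q -> tangent q (X q). Proof. by case: sX => + _; exact. Qed.

Let XX0 q : W q -> g q (X q) (X q) != 0.
Proof.
move=> Wq; apply: lt0r_neq0; apply: (metric_gt0 rg); first exact: tX.
by have [] := XV Wq.
Qed.

Let proj q v : functional M := (g q v (X q) / g q (X q) (X q)) *: X q.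

Let tangentB q u v : tangent q u -> tangent q v -> tangent q (u - v).
Proof.
by move=> tu tv; rewrite addrC -scaleN1r; exact: tangent_linear.
Qed.

Let metricBl q u v w : tangent q u -> tangent q v -> tangent q w ->
  g q (u - v) w = g q u w - g q v w.
Proof.
move=> tu tv tw; rewrite addrC -scaleN1r (metric_linearl rg) //; ring.
Qed.

Let tproj q v : W q -> tangent q (proj q v).
Proof. by move=> Wq; apply: tangentZ; exact: tX. Qed.

Let projP q v : W q -> tangent q v -> g q (v - proj q v) (X q) = 0.
Proof.
move=> Wq tv; rewrite metricBl //; [|exact: tproj|exact: tX].
by rewrite (metricZl rg) ?divfK ?subrr //; [exact: XX0|exact: tX..].
Qed.

Lemma orth_spans q w : W q ->
  tangent q w -> g q (X q) w = 0 -> orth g V q w.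
Proof.
move=> Wq tw Xw; split=> // u; have [_ ->] := XV Wq => -[k ->].
by rewrite (metricZl rg) ?Xw ?mulr0 //; exact: tX.
Qed.

Lemma spans_gen q : W q -> V q (X q).
Proof. by move=> Wq; have [_ ->] := XV Wq; exists 1; rewrite scale1r. Qed.

(** Testing the second form on the pair (X, X) shows that twice the derivative of X along itself has
    zero projection to the orthogonal plane, hence is orthogonal to that plane. *)
Lemma geodesic_generator p h : totally_geodesic g nabla U V -> W p ->
  tangent p h -> g p (X p) h = 0 -> g p (nabla X X p) h = 0.
Proof.
move=> tgV Wp th Xh.
have secX : is_section W V X by split=> // q; exact: spans_gen.
have := tgV W X X oW WU secX secX p Wp.
have tn : tangent p (nabla X X p).
  by have [+ _] := nabla_smooth LC oW sX sX; exact.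
rewrite /second_form; set v := _ + _ => /eqP.
have tv : tangent p v by exact: tangentDv.
rewrite scaler_eq0 invr_eq0 pnatr_eq0 /= => /eqP op0.
have [|_] := @oprojP (orth g V) p v.
  exists (v - proj p v); split.
    apply: orth_spans => //; first by apply: tangentB => //; exact: tproj.
    rewrite (metricC rg) ?projP //; first exact: tX.
    by apply: tangentB => //; exact: tproj.
  move=> u [tu Vu]; rewrite opprB addrC subrK.
  rewrite (metricZl rg) //; last exact: tX.
  by rewrite (metricC rg) ?(Vu _ (spans_gen Wp)) ?mulr0 //; exact: tX.
rewrite op0 subr0 => /(_ h (orth_spans Wp th Xh)).
rewrite /v (metricDl rg) //; lra.
Qed.

Lemma shear_free_generator : conformal g nabla U V -> exists kappa : M -> R,
  forall Y Z p, smooth_vfield W Y -> smooth_vfield W Z ->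
  (forall q, W q -> g q (X q) (Y q) = 0) ->
  (forall q, W q -> g q (X q) (Z q) = 0) -> W p ->
  g p (nabla Y Z p + nabla Z Y p) (X p) = kappa p * g p (Y p) (Z p).
Proof.
(* The symmetrized derivative has the same product with X as its projection 2 g(Y, Z) N; the factor
   2 undoes the one half in [second_form]. *)
move=> [N [[tN _] _] conf]; exists (fun p => 2 * g p (N p) (X p)).
move=> Y Z p sY sZ XY XZ Wp.
have sec A : smooth_vfield W A -> (forall q, W q -> g q (X q) (A q) = 0) ->
    is_section W (orth g V) A.
  move=> sA XA; split=> // q Wq; apply: orth_spans => //; last exact: XA.
  by have [+ _] := sA; exact.
have := conf W Y Z oW WU (sec _ sY XY) (sec _ sZ XZ) p Wp.
rewrite /second_form; set v := _ + _ => opN.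
have tv : tangent p v.
  apply: tangentDv.
    by have [+ _] := nabla_smooth LC oW sY sZ; exact.
  by have [+ _] := nabla_smooth LC oW sZ sY; exact.
have {opN} opN : oproj g V p v = (2 * g p (Y p) (Z p)) *: N p.
  by rewrite -scalerA -opN scalerA divff ?pnatr_eq0 // scale1r.
have [|_ /(_ (X p) (spans_gen Wp))] := @oprojP V p v.
  exists (proj p v); split; first by have [_ ->] := XV Wp; eexists.
  move=> u; have [_ ->] := XV Wp => -[k ->].
  have tvp : tangent p (v - proj p v) by apply: tangentB => //; exact: tproj.
  rewrite (metricC rg) //; last by apply: tangentZ; exact: tX.
  rewrite (metricZl rg) //; last exact: tX.
  by rewrite (metricC rg) ?projP ?mulr0 //; exact: tX.
have tNp := tN p (WU Wp).
rewrite opN metricBl //; [|exact: tangentZ|exact: tX].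
rewrite (metricZl rg) //; last exact: tX.
by move=> /eqP; rewrite subr_eq0 => /eqP ->; ring.
Qed.

End Generator.
End LineFields.

(** * From the foliation to its first-order equations *)

Section ConformalGeodesicFoliations.
Variables (R : realType) (M : manifoldType R 3) (g : metric M).
Hypothesis rg : riemannian g.
Variable nabla : connection M.
Hypothesis LC : levi_civita g nabla.
Variables (U : set M) (V : subbundle M).
Hypotheses (cV : conformal g nabla U V) (gV : totally_geodesic g nabla U V).

Lemma smooth_nonzero_open W (f : M -> R) p : open W -> W p -> smooth_on W f ->
  f p != 0 ->
  exists W', [/\ open W', W' p, W' `<=` W & forall q, W' q -> f q != 0].
Proof.
move=> oW Wp sf fp; have [c ac cp] := atlas_cover p.
have [oc _ _ cc _] := atlas_ok c ac.
rewrite continuous_open_subspace // in cc.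
have cp' : p \in chart_dom c by rewrite inE.
have df := smooth_at_diff ac cp (smooth_on_at oW Wp sf).
have nz : nbhs (chart_map c p) [set z | f (chart_inv c z) != 0].
  have := differentiable_continuous df; move=> /(_ [set x | x != 0]); apply.
  by rewrite /= chart_mapK //; exact: (open_nbhs_nbhs (conj (@open_neq _ 0) fp)).
have np : nbhs p (W `&` [set q | f q != 0]).
  apply: filterI; first exact: open_nbhs_nbhs.
  have ncp : nbhs p (chart_map c @^-1` [set z | f (chart_inv c z) != 0]).
    exact: (cc p cp' _ nz).
  have nd : nbhs p (chart_dom c) by exact: open_nbhs_nbhs.
  apply: filterS2 ncp nd => q /= + cq.
  by rewrite chart_mapK.
move: np; rewrite nbhsE => -[B [oB Bp] BW]; exists B.
by split=> // q /BW[].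
Qed.

Section Frame.
Variables (a b s : R) (e : adapted_frame g a b s).
Hypothesis det : a * b + s * s != 0.
Notation E1 := (fr1 e).
Notation E2 := (fr2 e).
Notation E3 := (fr3 e).
Notation fcomb := (frame_comb e).

Lemma transverse_foliation W (y z : M -> R) p : open W -> W p -> W `<=` U ->
  smooth_on W y -> smooth_on W z ->
  spans V W (fun q => fcomb q 1 (y q) (z q)) -> a = b.
Proof.
move=> oW Wp WU sy sz XV.
set X := fun q => _ in XV.
have sC c := @smooth_on_cst _ _ M W c.
have sD f h := @smooth_onD _ _ _ W f h oW.
have sM f h := @smooth_onM _ _ _ W f h oW.
have sN f := @smooth_onN _ _ _ W f oW.
have sX : smooth_vfield W X by exact: smooth_fcomb.
(* A basis of the plane orthogonal to X, left unnormalized so that all equations stay polynomial in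
   y and z. *)
pose H2 q := fcomb q (- y q) 1 0; pose H3 q := fcomb q (- z q) 0 1.
have sH2 : smooth_vfield W H2 by apply: smooth_fcomb => //; exact: sN.
have sH3 : smooth_vfield W H3 by apply: smooth_fcomb => //; exact: sN.
have XH2 q : W q -> g q (X q) (H2 q) = 0.
  by move=> _; rewrite (metric_fcomb rg); ring.
have XH3 q : W q -> g q (X q) (H3 q) = 0.
  by move=> _; rewrite (metric_fcomb rg); ring.
have [kappa kE] := shear_free_generator rg LC oW WU sX XV cV.
have eq_ A : forall q, W q -> A q = A q :> functional M by [].
have act_cst q x1 x2 x3 c : act (fcomb q x1 x2 x3) (fun=> c) = 0.
  by apply: tangent_cst; exact: tangent_fcomb.
have actN q x1 x2 x3 (f : M -> R) : W q -> smooth_on W f ->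
    act (fcomb q x1 x2 x3) (fun r => - f r) = - act (fcomb q x1 x2 x3) f.
  move=> Wq sf; have sfq := smooth_on_at oW Wq sf.
  by have [_ ->] := has_actN (tangent_fcomb e q x1 x2 x3) (conj sfq erefl).
(* The first two equations say that the derivative of X along itself is m X, where m is its
   e1-component. The other three are shear-freeness on (H2, H2), (H3, H3) and (H2, H3). *)
have eqs q : W q ->
  let Y1 := act (E1 q) y in let Y2 := act (E2 q) y in let Y3 := act (E3 q) y in
  let Z1 := act (E1 q) z in let Z2 := act (E2 q) z in let Z3 := act (E3 q) z in
  let m := a * y q * y q + b * z q * z q in
  [/\ Y1 + y q * Y2 + z q * Y3 = s * z q + a * y q + m * y q,
    Z1 + y q * Z2 + z q * Z3 = - (s * y q) + b * z q + m * z q &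
  [/\ 2 * (y q * Y1 - Y2 + a + a * y q * y q - s * y q * z q)
      = kappa q * (1 + y q * y q),
    2 * (z q * Z1 - Z3 + b + b * z q * z q + s * y q * z q)
      = kappa q * (1 + z q * z q) &
    y q * Z1 - Z2 + s * y q * y q + a * y q * z q
      + z q * Y1 - Y3 - s * z q * z q + b * y q * z q = kappa q * (y q * z q)]].
Proof.
  move=> Wq Y1 Y2 Y3 Z1 Z2 Z3 m.
  have g2 := geodesic_generator rg LC oW WU sX XV gV Wq (tangent_fcomb e q _ _ _) (XH2 q Wq).
  have g3 := geodesic_generator rg LC oW WU sX XV gV Wq (tangent_fcomb e q _ _ _) (XH3 q Wq).
  have nXX := nabla_fcomb rg LC oW (sC 1) sy sz (sC 1) sy sz (eq_ X) (eq_ X) Wq.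
  rewrite nXX (metric_fcomb rg) act_cst !act_fcomb -/Y1 -/Y2 -/Y3 -/Z1 -/Z2 -/Z3 in g2.
  rewrite nXX (metric_fcomb rg) act_cst !act_fcomb -/Y1 -/Y2 -/Y3 -/Z1 -/Z2 -/Z3 in g3.
  have k22 := kE _ _ _ sH2 sH2 XH2 XH2 Wq.
  have k33 := kE _ _ _ sH3 sH3 XH3 XH3 Wq.
  have k23 := kE _ _ _ sH2 sH3 XH2 XH3 Wq.
  have n22 := nabla_fcomb rg LC oW (sN _ sy) (sC 1) (sC 0) (sN _ sy) (sC 1) (sC 0)
    (eq_ H2) (eq_ H2) Wq.
  have n33 := nabla_fcomb rg LC oW (sN _ sz) (sC 0) (sC 1) (sN _ sz) (sC 0) (sC 1)
    (eq_ H3) (eq_ H3) Wq.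
  have n23 := nabla_fcomb rg LC oW (sN _ sy) (sC 1) (sC 0) (sN _ sz) (sC 0) (sC 1)
    (eq_ H2) (eq_ H3) Wq.
  have n32 := nabla_fcomb rg LC oW (sN _ sz) (sC 0) (sC 1) (sN _ sy) (sC 1) (sC 0)
    (eq_ H3) (eq_ H2) Wq.
  rewrite n22 fcombD !(metric_fcomb rg) !act_cst !actN // !act_fcomb -/Y1 -/Y2 -/Y3 in k22.
  rewrite n33 fcombD !(metric_fcomb rg) !act_cst !actN // !act_fcomb -/Z1 -/Z2 -/Z3 in k33.
  rewrite n23 n32 fcombD !(metric_fcomb rg) !act_cst !actN // !act_fcomb in k23.
  rewrite -/Y1 -/Y2 -/Y3 -/Z1 -/Z2 -/Z3 in k23.
  rewrite /m; split; [lra|lra|split; [lra|lra|lra]].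
(* tau and rho are read off from E2 z and E2 y, so that two of the six formulas hold by construction
   and both functions are smooth. *)
pose u q := 1 + z q * z q.
have u0 q : u q != 0.
  by apply: lt0r_neq0; rewrite /u; have := sqr_ge0 (z q); rewrite expr2; lra.
pose tau q := (act (E2 q) z + - a * (y q * z q)) * (u q)^-1.
pose rho q := act (E2 q) y + - a * (y q * y q + 1) + - (y q * (z q * tau q)).
have sE2 : smooth_vfield W E2.
  exact: smooth_vfield_sub (@subsetT _ W) (smooth_fr2 e).
have st : smooth_on W tau.
  apply: (sM _ _ (sD _ _ (smooth_act oW sE2 sz) (sM _ _ (sC _) (sM _ _ sy sz)))).
  by apply: smooth_onV => //; exact: (sD _ _ (sC 1) (sM _ _ sz sz)).
have sr : smooth_on W rho.
  exact: (sD _ _ (sD _ _ (smooth_act oW sE2 sy)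
    (sM _ _ (sC _) (sD _ _ (sM _ _ sy sy) (sC 1)))) (sN _ (sM _ _ sy (sM _ _ sz st)))).
have E2z q : act (E2 q) z = tau q * (1 + z q * z q) + a * (y q * z q).
  by rewrite /tau -/(u q) divfK //; ring.
have E2y q : act (E2 q) y =
    rho q + a * (y q * y q) + y q * (z q * tau q) + a by rewrite /rho; ring.
have sol q : W q -> [/\ act (E1 q) y = z q * tau q - y q * rho q + s * z q,
  act (E3 q) y = b * (y q * z q) - tau q * (1 + y q * y q),
  act (E1 q) z = - (y q * tau q) - z q * rho q - s * y q &
  act (E3 q) z = rho q + b * (z q * z q) - y q * (z q * tau q) + b].
  move=> Wq; have [q1 q2 [q3 q4 q5]] := eqs q Wq.
  rewrite E2y E2z in q1 q2 q3 q4 q5.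
  have uz0 := u0 q; have pos : 1 + y q * y q + z q * z q != 0.
    apply: lt0r_neq0; have := sqr_ge0 (z q); have := sqr_ge0 (y q).
    by rewrite !expr2; lra.
  move: (act (E1 q) y) (act (E3 q) y) (act (E1 q) z) (act (E3 q) z) (kappa q)
    (rho q) (tau q) q1 q2 q3 q4 q5 uz0 pos; rewrite /u.
  move: (y q) (z q) => Y Z Y1 Y3 Z1 Z3 k0 r t q1 q2 q3 q4 q5 uz0 pos.
  have cancel (x c : R) : c != 0 -> x * c = 0 -> x = 0.
    by move=> c0 /eqP; rewrite mulf_eq0 (negPf c0) orbF => /eqP.
  have mul c (A B : R) : A = B -> c * A = c * B by move=> ->.
  (* k, d1, d3, f1 and f3 are the defects of kappa = - 2 rho and of the four remaining formulas.
     They solve a homogeneous linear system, which is eliminated with the nonzero factors 1 + z^2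
     and 1 + y^2 + z^2. *)
  pose k := k0 + 2 * r.
  pose d1 := Y1 - (Z * t - Y * r + s * Z).
  pose d3 := Y3 - (b * (Y * Z) - t * (1 + Y * Y)).
  pose f1 := Z1 - (- (Y * t) - Z * r - s * Y).
  pose f3 := Z3 - (r + b * (Z * Z) - Y * (Z * t) + b).
  have h1 : d1 = - (Z * d3) by rewrite /d1 /d3; lra.
  have h2 : f1 = - (Z * f3) by rewrite /f1 /f3; lra.
  have h3 : 2 * Y * d1 = k * (1 + Y * Y) by rewrite /d1 /k; lra.
  have h4 : 2 * (Z * f1 - f3) = k * (1 + Z * Z) by rewrite /f1 /f3 /k; lra.
  have h5 : Y * f1 + Z * d1 - d3 = k * (Y * Z) by rewrite /d1 /d3 /f1 /k; lra.
  have k3 : k + 2 * f3 = 0.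
    by apply: (cancel _ _ uz0); rewrite h2 in h4; lra.
  have kE' : k = - (2 * f3) by lra.
  have e3 : (1 + Z * Z) * d3 = f3 * (Y * Z) by rewrite h1 h2 kE' in h5; lra.
  have f30 : f3 = 0.
    apply: (cancel _ _ pos); rewrite h1 kE' in h3.
    have h3' : f3 * (1 + Y * Y) = Y * Z * d3 by lra.
    have := mul (1 + Z * Z) _ _ h3'; have := mul (Y * Z) _ _ e3; lra.
  have d30 : d3 = 0.
    by apply: (cancel _ _ uz0); rewrite mulrC e3 f30 mul0r.
  have f10 : f1 = 0 by rewrite h2 f30 mulr0 oppr0.
  have d10 : d1 = 0 by rewrite h1 d30 mulr0 oppr0.
  by move: d10 d30 f10 f30; rewrite /d1 /d3 /f1 /f3; split; lra.
apply: (transverse_direction (e := e) det oW Wp sy sz sr st).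
- by move=> q /sol[].
- by move=> q _; exact: E2y.
- by move=> q /sol[].
- by move=> q /sol[].
- by move=> q _; exact: E2z.
- by move=> q /sol[].
Qed.

(** Two conditions suffice: the geodesic equation tested against e1, and shear-freeness on the pair
    H1, H, whose orthogonality removes the unknown factor kappa. *)
Lemma ideal_foliation W (z : M -> R) p : open W -> W p -> W `<=` U ->
  smooth_on W z -> spans V W (fun q => fcomb q 0 1 (z q)) -> a = b.
Proof.
move=> oW Wp WU sz XV.
set X := fun q => _ in XV.
have sC c := @smooth_on_cst _ _ M W c.
have sN f := @smooth_onN _ _ _ W f oW.
have sX : smooth_vfield W X by exact: smooth_fcomb.
pose H1 q := fcomb q 1 0 0; pose H q := fcomb q 0 (- z q) 1.
have sH1 : smooth_vfield W H1 by exact: smooth_fcomb.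
have sH : smooth_vfield W H by apply: smooth_fcomb => //; exact: sN.
have XH1 q : W q -> g q (X q) (H1 q) = 0.
  by move=> _; rewrite (metric_fcomb rg); ring.
have XH q : W q -> g q (X q) (H q) = 0.
  by move=> _; rewrite (metric_fcomb rg); ring.
have [kappa kE] := shear_free_generator rg LC oW WU sX XV cV.
have eq_ A : forall q, W q -> A q = A q :> functional M by [].
have act_cst q x1 x2 x3 c : act (fcomb q x1 x2 x3) (fun=> c) = 0.
  by apply: tangent_cst; exact: tangent_fcomb.
have actN q x1 x2 x3 (f : M -> R) : W q -> smooth_on W f ->
    act (fcomb q x1 x2 x3) (fun r => - f r) = - act (fcomb q x1 x2 x3) f.
  move=> Wq sf; have sfq := smooth_on_at oW Wq sf.
  by have [_ ->] := has_actN (tangent_fcomb e q x1 x2 x3) (conj sfq erefl).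
apply: (ideal_direction (e := e) det oW Wp sz) => [q Wq|].
  have := geodesic_generator rg LC oW WU sX XV gV Wq (tangent_fcomb e q _ _ _) (XH1 q Wq).
  rewrite (nabla_fcomb rg LC oW (sC 0) (sC 1) sz (sC 0) (sC 1) sz (eq_ X) (eq_ X) Wq).
  by rewrite (metric_fcomb rg) act_cst; lra.
have := kE _ _ _ sH1 sH XH1 XH Wp.
rewrite (nabla_fcomb rg LC oW (sC 1) (sC 0) (sC 0) (sC 0) (sN _ sz) (sC 1)
  (eq_ H1) (eq_ H) Wp).
rewrite (nabla_fcomb rg LC oW (sC 0) (sN _ sz) (sC 1) (sC 1) (sC 0) (sC 0)
  (eq_ H) (eq_ H1) Wp).
by rewrite fcombD !(metric_fcomb rg) !act_cst !actN // !act_fcomb; lra.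
Qed.

End Frame.

(** Covers a generator in the ideal whose e2-component vanishes at the base point: after the
    exchange of e2 and e3 it can be normalized as in [ideal_foliation]. *)
Lemma swapped_frame (a b s : R) (e : adapted_frame g a b s) :
  exists e' : adapted_frame g b a (- s),
    forall p x y z, frame_comb e' p x y z = frame_comb e p x z y.
Proof.
have fr32 p : g p (fr3 e p) (fr2 e p) = 0.
  by rewrite (metricC rg) ?fr23 //; [exact: tE3|exact: tE2].
pose f := OrthonormalFrame (smooth_fr1 e) (smooth_fr3 e) (smooth_fr2 e)
  (fr11 e) (fr33 e) (fr22 e) (fr13 e) (fr12 e) fr32.
have sw p x y z : frame_comb f p x y z = frame_comb e p x z y.
  by rewrite /frame_comb /= [y *: _ + _]addrC.
have b12 p : bracket (fr1 f) (fr2 f) p = frame_comb f p 0 b (- s).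
  by rewrite sw; exact: br13.
have b13 p : bracket (fr1 f) (fr3 f) p = frame_comb f p 0 (- - s) a.
  by rewrite sw opprK; exact: br12.
have b23 p : bracket (fr2 f) (fr3 f) p = 0 by rewrite bracketC br23 oppr0.
by exists (AdaptedFrame b12 b13 b23) => p x y z; exact: sw.
Qed.

Lemma foliation_symmetric_frame (a b s : R) (e : adapted_frame g a b s) p :
  a * b + s * s != 0 -> Defs.distribution 1 U V -> open U -> U p -> a = b.
Proof.
move=> det dV oU Up; have [W [X [oW Wp WU sX XV]]] := line_generator dV Up.
have [tX _] := sX.
have sW := smooth_vfield_sub (@subsetT _ W).
pose x1 q := g q (X q) (fr1 e q); pose x2 q := g q (X q) (fr2 e q).
pose x3 q := g q (X q) (fr3 e q).
have sx1 : smooth_on W x1 by apply: smooth_metric => //; exact/sW/smooth_fr1.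
have sx2 : smooth_on W x2 by apply: smooth_metric => //; exact/sW/smooth_fr2.
have sx3 : smooth_on W x3 by apply: smooth_metric => //; exact/sW/smooth_fr3.
have XE q (Wq : W q) : X q = frame_comb e q (x1 q) (x2 q) (x3 q).
  exact: tangent_fcombE (tX q Wq).
have normalize x q : W q -> x q != 0 -> smooth_on W x -> exists W',
    [/\ open W', W' q, W' `<=` W, W' `<=` U & smooth_on W' (fun r => (x r)^-1) /\
    (forall r, W' r -> x r != 0) /\ spans V W' (fun r => (x r)^-1 *: X r)].
  move=> Wq xq sx; have [W' [oW' W'q sW' x0]] := smooth_nonzero_open oW Wq sx xq.
  exists W'; split=> //; first exact: subset_trans WU.
  split; first by apply: smooth_onV => //; exact: smooth_on_sub sx.
  by split=> //; apply: spans_scale XV => // r /x0; rewrite invr_eq0.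
have spans_eq W' Y Z : (forall q, W' q -> Y q = Z q) -> spans V W' Y -> spans V W' Z.
  by move=> YZ YV q W'q; rewrite -YZ //; exact: YV.
(* The alternative concerns all of W and not just p: one case needs a neighborhood with x1 nonzero,
   around a possibly different point q, the other needs x1 = 0 on an open set. *)
have [[q [Wq x1q]]|x10] := pselect (exists q, W q /\ x1 q != 0).
  have [W' [oW' W'q sW' W'U [sV [x0 YV]]]] := normalize _ _ Wq x1q sx1.
  have sM f : smooth_on W f -> smooth_on W' (fun r => (x1 r)^-1 * f r).
    by move=> sf; apply: smooth_onM => //; exact: smooth_on_sub sf.
  apply: (transverse_foliation (e := e) det oW' W'q W'U (sM _ sx2) (sM _ sx3)).
  by apply: spans_eq YV => r W'r; rewrite XE ?fcombZ ?mulVf //; [exact: x0|exact: sW'].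
have {}x10 q : W q -> x1 q = 0.
  by move=> Wq; apply/eqP; apply: contraPT x10 => x1q; apply; exists q.
have [x2p|x2p] := eqVneq (x2 p) 0; last first.
  have [W' [oW' W'p sW' W'U [sV [x0 YV]]]] := normalize _ _ Wp x2p sx2.
  have sz : smooth_on W' (fun r => (x2 r)^-1 * x3 r).
    by apply: smooth_onM => //; exact: smooth_on_sub sx3.
  apply: (ideal_foliation (e := e) det oW' W'p W'U sz).
  apply: spans_eq YV => r W'r; have Wr := sW' r W'r.
  by rewrite XE // fcombZ x10 // mulr0 mulVf //; exact: x0.
have x3p : x3 p != 0.
  apply/eqP => x3p; have [/eqP[]] := XV p Wp.
  by rewrite XE // x10 // x2p x3p fcomb0.
have [W' [oW' W'p sW' W'U [sV [x0 YV]]]] := normalize _ _ Wp x3p sx3.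
have sz : smooth_on W' (fun r => (x3 r)^-1 * x2 r).
  by apply: smooth_onM => //; exact: smooth_on_sub sx2.
have det' : b * a + - s * - s != 0 by rewrite mulrNN mulrC.
have [e' sw] := swapped_frame e.
apply/esym/(ideal_foliation (e := e') det' oW' W'p W'U sz).
apply: spans_eq YV => r W'r; have Wr := sW' r W'r.
by rewrite sw XE // fcombZ x10 // mulr0 mulVf ?x0.
Qed.

End ConformalGeodesicFoliations.

(** * Lie algebras *)

Section EuclideanLieAlgebra.
Variables (R : realType) (L : vectType R) (br : lie_bracket L).
Hypothesis dimL : \dim {: L} = 3%N.
Variable ip : L -> L -> R.
Hypotheses (ip_linl : forall c u v w, ip (c *: u + v) w = c * ip u w + ip v w)
  (ipC : forall u v, ip u v = ip v u) (ip_gt0 : forall u, u != 0 -> 0 < ip u u).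

Let ip0 w : ip 0 w = 0.
Proof. by have := ip_linl (-1) 0 0 w; rewrite scaler0 addr0; lra. Qed.

Let ipD u v w : ip (u + v) w = ip u w + ip v w.
Proof. by rewrite -[u in LHS]scale1r ip_linl mul1r. Qed.

Let ipZ c u w : ip (c *: u) w = c * ip u w.
Proof. by rewrite -[_ *: _]addr0 ip_linl ip0 addr0. Qed.

Let ip_sum n (F : 'I_n -> L) w : ip (\sum_i F i) w = \sum_i ip (F i) w.
Proof. by apply: (big_morph (fun u => ip u w)) => [u v|]; [exact: ipD|exact: ip0]. Qed.

(** Fewer than three linear equations in a three-dimensional space have a nonzero solution. Three
    uses of this replace the Gram-Schmidt process. *)
Lemma unit_orthogonal k (t : 'I_k -> L) : (k < 3)%N ->
  exists2 n, ip n n = 1 & forall i, ip n (t i) = 0.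
Proof.
move=> k3; pose A : 'M[R]_(\dim {:L}, k) :=
  \matrix_(i, j) ip (vbasis {:L})`_i (t j).
have /rowV0Pn[x /sub_kermxP xA x0] : kermx A != 0.
  rewrite -mxrank_eq0 mxrank_ker -lt0n subn_gt0.
  by apply: leq_ltn_trans (rank_leq_col A) _; rewrite dimL.
pose v := \sum_i x 0 i *: (vbasis {:L})`_i.
have v0 : v != 0.
  apply: contraNneq x0 => v0; apply/eqP/rowP => i; rewrite mxE.
  by have /freeP/(_ (x 0) v0 i) := basis_free (vbasisP {:L}).
have vt j : ip v (t j) = 0.
  rewrite ip_sum -[RHS](_ : (x *m A) 0 j = 0); last by rewrite xA mxE.
  by rewrite mxE; apply: eq_bigr => i _; rewrite ipZ mxE.
have N0 : 0 < Num.sqrt (ip v v) by rewrite sqrtr_gt0 ip_gt0.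
exists ((Num.sqrt (ip v v))^-1 *: v) => [|j]; last by rewrite ipZ vt mulr0.
rewrite ipZ ipC ipZ mulrA -expr2 exprVn sqr_sqrtr ?ltW ?ip_gt0 //.
by rewrite mulVf // gt_eqF // ip_gt0.
Qed.

Section OrthonormalBasis.
Variables e1 e2 e3 : L.
Hypotheses (e11 : ip e1 e1 = 1) (e22 : ip e2 e2 = 1) (e33 : ip e3 e3 = 1)
  (e12 : ip e1 e2 = 0) (e13 : ip e1 e3 = 0) (e23 : ip e2 e3 = 0).

Definition comb x y z : L := x *: e1 + (y *: e2 + z *: e3).

Lemma ip_comb x y z x' y' z' :
  ip (comb x y z) (comb x' y' z') = x * x' + (y * y' + z * z').
Proof.
have ipr w : ip w (comb x' y' z') = x' * ip w e1 + (y' * ip w e2 + z' * ip w e3).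
  by rewrite ipC ip_linl ip_linl ipZ !(ipC _ w).
rewrite ip_linl ip_linl ipZ !ipr (ipC e2 e1) (ipC e3 e1) (ipC e3 e2).
by rewrite e11 e22 e33 e12 e13 e23; ring.
Qed.

Lemma comb_e1 : comb 1 0 0 = e1.
Proof. by rewrite /comb !scale0r scale1r !addr0. Qed.
Lemma comb_e2 : comb 0 1 0 = e2.
Proof. by rewrite /comb !scale0r scale1r addr0 add0r. Qed.
Lemma comb_e3 : comb 0 0 1 = e3.
Proof. by rewrite /comb !scale0r scale1r !add0r. Qed.

Lemma combZ c x y z : c *: comb x y z = comb (c * x) (c * y) (c * z).
Proof. by rewrite /comb !scalerDr !scalerA. Qed.
Lemma combD x y z x' y' z' :
  comb x y z + comb x' y' z' = comb (x + x') (y + y') (z + z').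
Proof. by rewrite /comb !scalerDl addrACA; congr (_ + _); rewrite addrACA. Qed.

Lemma comb_inj x y z x' y' z' : comb x y z = comb x' y' z' ->
  [/\ x = x', y = y' & z = z'].
Proof.
move=> h; have i1 := congr1 (ip^~ (comb 1 0 0)) h.
have i2 := congr1 (ip^~ (comb 0 1 0)) h; have i3 := congr1 (ip^~ (comb 0 0 1)) h.
by rewrite /= !ip_comb in i1 i2 i3; split; lra.
Qed.

Lemma combE v : v = comb (ip v e1) (ip v e2) (ip v e3).
Proof.
suff [x [y [z ->]]] : exists x y z, v = comb x y z.
  have i1 : ip (comb x y z) e1 = x by rewrite -[X in ip _ X]comb_e1 ip_comb; ring.
  have i2 : ip (comb x y z) e2 = y by rewrite -[X in ip _ X]comb_e2 ip_comb; ring.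
  have i3 : ip (comb x y z) e3 = z by rewrite -[X in ip _ X]comb_e3 ip_comb; ring.
  by rewrite i1 i2 i3.
have fe : free [:: e1; e2; e3].
  apply/(@freeP _ _ _ [tuple e1; e2; e3]) => k.
  rewrite !big_ord_recl big_ord0 addr0 /= -/(comb _ _ _) => k0.
  have {}k0 : comb (k ord0) (k (lift ord0 ord0)) (k (lift ord0 (lift ord0 ord0)))
      = comb 0 0 0 by rewrite k0 /comb !scale0r !addr0.
  have [k1 k2 k3] := comb_inj k0 => i.
  have [->//|[->//|->//]] : i = ord0 \/ i = lift ord0 ord0 \/ i = lift ord0 (lift ord0 ord0)
    by case: i => [[|[|[|//]]] li]; [left|right; left|right; right]; exact/val_inj.
have bE : basis_of {:L} [:: e1; e2; e3].
  by rewrite basisEfree fe dimL leqnn andbT; apply/subvP => w _; exact: memvf.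
have := coord_basis (X := [tuple e1; e2; e3]) bE (memvf v).
rewrite !big_ord_recl big_ord0 addr0 /= => vE.
by do 3!eexists; exact: vE.
Qed.

Let brDl u v w : br (u + v) w = br u w + br v w.
Proof. by have := brk_linearl br w 1 u v; rewrite !scale1r. Qed.
Let brDr u v w : br w (u + v) = br w u + br w v.
Proof. by have := brk_linearr br w 1 u v; rewrite !scale1r. Qed.
Let br0l w : br 0 w = 0.
Proof. by apply: (@addrI _ (br 0 w)); rewrite -brDl !addr0. Qed.
Let br0r w : br w 0 = 0.
Proof. by apply: (@addrI _ (br w 0)); rewrite -brDr !addr0. Qed.
Let brZl c u w : br (c *: u) w = c *: br u w.
Proof. by have := brk_linearl br w c u 0; rewrite !addr0 br0l addr0. Qed.
Let brZr c u w : br w (c *: u) = c *: br w u.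
Proof. by have := brk_linearr br w c u 0; rewrite !addr0 br0r addr0. Qed.
Let brC u v : br v u = - br u v.
Proof.
apply/eqP; rewrite -addr_eq0; apply/eqP.
by have := brk_alt br (u + v); rewrite brDl !brDr !brk_alt add0r addr0 addrC.
Qed.

Variables al ga be de mu nu : R.
Hypotheses (b12 : br e1 e2 = comb 0 al ga) (b13 : br e1 e3 = comb 0 be de)
  (b23 : br e2 e3 = comb 0 mu nu).

Lemma br_comb x y z x' y' z' : br (comb x y z) (comb x' y' z') = comb 0
  (al * (x * y' - y * x') + be * (x * z' - z * x') + mu * (y * z' - z * y'))
  (ga * (x * y' - y * x') + de * (x * z' - z * x') + nu * (y * z' - z * y')).
Proof.
rewrite {1 2}/comb !(brDl, brDr, brZl, brZr) !brk_alt !scaler0.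
rewrite (brC e1 e2) (brC e1 e3) (brC e2 e3) b12 b13 b23.
have -> : (0 : L) = comb 0 0 0 by rewrite /comb !scale0r !addr0.
have combN u v w : - comb u v w = comb (- u) (- v) (- w).
  by rewrite -scaleN1r combZ !mulN1r.
rewrite !combN !(combZ, combD).
by congr comb; ring.
Qed.

Hypothesis cL : centerless br.

Lemma central_comb x y z :
  (forall x' y' z', br (comb x y z) (comb x' y' z') = comb 0 0 0) ->
  [/\ x = 0, y = 0 & z = 0].
Proof.
have c0 : comb 0 0 0 = 0 by rewrite /comb !scale0r !addr0.
move=> h; apply: comb_inj; rewrite c0.
have : [set x : L | forall y, br x y = 0] (comb x y z).
  by move=> w; rewrite (combE w) h c0.
by rewrite [X in X _]cL.
Qed.

Lemma abelian_ideal : [/\ mu = 0, nu = 0 & al * de - be * ga != 0].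
Proof.
(* Let A be ad e1 on <e2, e3> and w = [e2, e3]. Jacobi's identity is A w = tr(A) w, that is adj(A) w
   = 0 by Cayley-Hamilton; multiplying by A gives det(A) w = 0, which is [D1] and [D2]. *)
have J : be * nu - de * mu = 0 /\ ga * mu - al * nu = 0.
  have := brk_jacobi br e1 e2 e3.
  rewrite -comb_e1 -comb_e2 -comb_e3 !br_comb !combD.
  have -> : (0 : L) = comb 0 0 0 by rewrite /comb !scale0r !addr0.
  by move/comb_inj => [_ h1 h2]; split; lra.
have [J1 J2] := J.
have sq0 (u v : R) : u * u + v * v = 0 -> u = 0 /\ v = 0.
  move/eqP; rewrite -!expr2 paddr_eq0 ?sqr_ge0 // !sqrf_eq0.
  by case/andP => /eqP -> /eqP ->.
have D1 : mu * (al * de - be * ga) = 0.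
  transitivity (- al * (be * nu - de * mu) - be * (ga * mu - al * nu)); first by ring.
  by rewrite J1 J2 !mulr0 subrr.
have D2 : nu * (al * de - be * ga) = 0.
  transitivity (- ga * (be * nu - de * mu) - de * (ga * mu - al * nu)); first by ring.
  by rewrite J1 J2 !mulr0 subrr.
(* If w is nonzero, adj(A) w = 0 makes both columns of A multiples of w. This is why the vector
   |w|^2 e1 - <A e3, w> e2 + <A e2, w> e3 is central, so that |w|^2 = 0. *)
have [/sq0[mu0 nu0] _ _] : [/\ mu * mu + nu * nu = 0,
    - (be * mu + de * nu) = 0 & al * mu + ga * nu = 0].
  apply: central_comb => x y z; rewrite br_comb; congr comb.
    transitivity (- nu * (ga * mu - al * nu) * y + nu * (be * nu - de * mu) * z
      + nu * (al * de - be * ga) * x); first by ring.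
    by rewrite J1 J2 D2 !(mulr0, mul0r) !addr0.
  transitivity (mu * (ga * mu - al * nu) * y - mu * (be * nu - de * mu) * z
      - mu * (al * de - be * ga) * x); first by ring.
  by rewrite J1 J2 D1 !(mulr0, mul0r) !subr0.
split=> //; apply/eqP => D0.
(* Once w = 0, a kernel vector of A is central. If det(A) = 0, then (be, -al) and (de, -ga) lie in
   the kernel, so A = 0 and e2 itself is central. *)
have cen y z : al * y + be * z = 0 -> ga * y + de * z = 0 -> y = 0 /\ z = 0.
  move=> h1 h2; suff [] : [/\ (0 : R) = 0, y = 0 & z = 0] by [].
  apply: central_comb => x' y' z'; rewrite br_comb mu0 nu0; congr comb.
    by transitivity (- x' * (al * y + be * z)); [ring|rewrite h1 mulr0].
  by transitivity (- x' * (ga * y + de * z)); [ring|rewrite h2 mulr0].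
have [be0 /eqP] : be = 0 /\ - al = 0 by apply: cen; lra.
rewrite oppr_eq0 => /eqP al0.
have [de0 /eqP] : de = 0 /\ - ga = 0.
  by apply: cen; rewrite ?al0 ?be0; ring.
rewrite oppr_eq0 => /eqP ga0.
have [/eqP] : (1 : R) = 0 /\ (0 : R) = 0.
  by apply: cen; rewrite ?al0 ?be0 ?de0 ?ga0; ring.
by rewrite oner_eq0.
Qed.

End OrthonormalBasis.

(** * Solvability and the normal form of the Lie algebra *)

Lemma bracket_derived x y : br x y \in derived_algebra br {:L}.
Proof.
set D := derived_algebra br _.
have bil u v : u \in vbasis {:L} -> v \in vbasis {:L} -> br u v \in D.
  by move=> hu hv; apply: memv_span; apply/allpairsP; exists (u, v).
have sum_in (f : L -> L) : linear f ->
    (forall v, v \in vbasis {:L} -> f v \in D) -> forall v, f v \in D.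
  move=> lf hf v; rewrite (coord_vbasis (memvf v)).
  have f0 : f 0 = 0.
    by have := lf (-1) 0 0; rewrite scaler0 addr0 scaleN1r addNr.
  elim/big_rec: _ => [|i u _ hu]; first by rewrite f0 mem0v.
  rewrite lf memvD // memvZ // hf // mem_nth // size_tuple.
  exact: ltn_ord.
apply: (sum_in (br^~ y)); first exact: brk_linearl.
move=> u hu; apply: (sum_in (br u)); first exact: brk_linearr.
by move=> v; exact: bil.
Qed.

(** Otherwise the derived series would be constant and never reach zero. *)
Lemma derived_proper : solvable_lie_algebra br ->
  (\dim (derived_algebra br {:L}) < 3)%N.
Proof.
move=> [k Dk]; rewrite -dimL ltn_neqAle dimvS ?subvf // andbT.
apply/eqP => dE; have fD : derived_algebra br fullv = fullv.
  by apply/eqP; rewrite eqEdim subvf dE leqnn.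
have Dfull n : iter n (derived_algebra br) fullv = fullv.
  by elim: n => //= n ->.
by move: dimL; rewrite -(Dfull k) Dk dimv0.
Qed.

(* A rotation of the ideal makes the off-diagonal part of ad e1 skew. *)
Lemma skew_rotation (q h : R) :
  exists c d : R, c * c + d * d = 1 /\ h * (c * c - d * d) + 2 * q * (c * d) = 0.
Proof.
have [->|h0] := eqVneq h 0; first by exists 1, 0; split; ring.
(* (h, q + r) is an eigenvector, for the eigenvalue r, of the symmetric matrix with rows (-q, h) and
   (h, q). In the application this matrix is twice the trace-free symmetric part of ad e1. For h = 0
   the vector can vanish, hence the separate case. *)
pose r := Num.sqrt (q ^+ 2 + h ^+ 2).
have r2 : r ^+ 2 = q ^+ 2 + h ^+ 2 by rewrite sqr_sqrtr // addr_ge0 ?sqr_ge0.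
pose D := q + r; pose n := Num.sqrt (h ^+ 2 + D ^+ 2).
have n2 : n ^+ 2 = h ^+ 2 + D ^+ 2 by rewrite sqr_sqrtr // addr_ge0 ?sqr_ge0.
have n0 : n != 0.
  rewrite -sqrf_eq0 n2 paddr_eq0 ?sqr_ge0 // negb_and !sqrf_eq0.
  by rewrite h0.
exists (h / n), (D / n); split.
  transitivity ((h ^+ 2 + D ^+ 2) / n ^+ 2); first by field.
  by rewrite n2 divff // -n2 sqrf_eq0.
transitivity (h * (q ^+ 2 + h ^+ 2 - r ^+ 2) / n ^+ 2).
  by rewrite /D; field.
by rewrite r2 subrr mulr0 mul0r.
Qed.

Lemma solvable_normal_form : centerless br -> solvable_lie_algebra br ->
  exists (e1 e2 e3 : L) (a b s : R),
  [/\ [/\ ip e1 e1 = 1, ip e2 e2 = 1 & ip e3 e3 = 1],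
      [/\ ip e1 e2 = 0, ip e1 e3 = 0 & ip e2 e3 = 0],
      [/\ br e1 e2 = a *: e2 + s *: e3, br e1 e3 = - s *: e2 + b *: e3 &
          br e2 e3 = 0] &
      a * b + s * s != 0].
Proof.
move=> cL sL.
pose D := derived_algebra br fullv.
have [e1 e11 e1D] := unit_orthogonal (fun i => (vbasis D)`_i) (derived_proper sL).
have brD x y : ip (br x y) e1 = 0.
  rewrite (coord_vbasis (bracket_derived x y)) ip_sum big1 // => i _.
  by rewrite ipZ ipC e1D mulr0.
have [f2 f22 f2o] := unit_orthogonal (fun _ : 'I_1 => e1) isT.
have e1f2 : ip e1 f2 = 0 by rewrite ipC (f2o ord0).
have [f3 f33 f3o] := unit_orthogonal (fun i : 'I_2 => if i == ord0 then e1 else f2) isT.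
have e1f3 : ip e1 f3 = 0 by rewrite ipC (f3o ord0).
have f23 : ip f2 f3 = 0 by rewrite ipC (f3o (lift ord0 ord0)).
have bE x y : br x y = comb e1 f2 f3 0 (ip (br x y) f2) (ip (br x y) f3).
  by rewrite -(brD x y); exact: combE.
set al := ip (br e1 f2) f2; set ga := ip (br e1 f2) f3.
set be := ip (br e1 f3) f2; set de := ip (br e1 f3) f3.
have [mu0 nu0 det] : [/\ ip (br f2 f3) f2 = 0, ip (br f2 f3) f3 = 0 &
    al * de - be * ga != 0].
  by apply: (abelian_ideal e11 f22 f33 e1f2 e1f3 f23 (bE _ _) (bE _ _) (bE _ _)).
have [c [d [cd skew]]] := skew_rotation (de - al) (be + ga).
have ipE := ip_comb e11 f22 f33 e1f2 e1f3 f23.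
have brE := br_comb (bE e1 f2) (bE e1 f3) (bE f2 f3).
pose e2 := comb e1 f2 f3 0 c d; pose e3 := comb e1 f2 f3 0 (- d) c.
have E1 : e1 = comb e1 f2 f3 1 0 0 by rewrite comb_e1.
exists e1, e2, e3.
(* The witnesses a, b, s are entries of ad e1 in the rotated basis: the products of [e1, e2] with
   e2, of [e1, e3] with e3 and of [e1, e2] with e3. *)
exists (c * (c * al + d * be) + d * (c * ga + d * de)).
exists (- d * (- d * al + c * be) + c * (- d * ga + c * de)).
exists (- d * (c * al + d * be) + c * (c * ga + d * de)).
split.
- by rewrite e11 /e2 /e3 !ipE -cd; split=> //; ring.
- by rewrite /e2 /e3 {1 3}E1 !ipE; split; ring.
- rewrite {1 2}E1 /e2 /e3 !brE mu0 nu0 -/al -/be -/ga -/de.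
  rewrite !combZ !combD.
  have -> : (0 : L) = comb e1 f2 f3 0 0 0 by rewrite /comb !scale0r !addr0.
  have fin y z y' z' : y = y' -> z = z' ->
    comb e1 f2 f3 0 y z = comb e1 f2 f3 (0 + 0) y' z' by rewrite addr0 => -> ->.
  split.
  + rewrite !mulr0; apply: fin.
      transitivity ((c * c + d * d) * (c * al + d * be)); last by ring.
      by rewrite cd; ring.
    transitivity ((c * c + d * d) * (c * ga + d * de)); last by ring.
    by rewrite cd; ring.
  + have s' : - (- d * (c * al + d * be) + c * (c * ga + d * de)) =
      c * (- d * al + c * be) + d * (- d * ga + c * de).
      by apply/eqP; rewrite -subr_eq0 -oppr_eq0 -[X in _ == X]skew; apply/eqP; ring.
    rewrite s' !mulr0; apply: fin.
      transitivity ((c * c + d * d) * (- d * al + c * be)); last by ring.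
      by rewrite cd; ring.
    transitivity ((c * c + d * d) * (- d * ga + c * de)); last by ring.
    by rewrite cd; ring.
  + by rewrite -[in RHS](addr0 0); apply: fin; ring.
(* Rotations preserve the determinant of ad e1 on the ideal. Replacing one factor s by minus the
   other off-diagonal entry turns a b + s^2 into that determinant. *)
- suff -> : (c * (c * al + d * be) + d * (c * ga + d * de)) *
     (- d * (- d * al + c * be) + c * (- d * ga + c * de)) +
     (- d * (c * al + d * be) + c * (c * ga + d * de)) *
     (- d * (c * al + d * be) + c * (c * ga + d * de)) =
     (c * c + d * d) * (c * c + d * d) * (al * de - be * ga).
    by rewrite cd !mul1r.
  have s' : - d * (c * al + d * be) + c * (c * ga + d * de) =
      - (c * (- d * al + c * be) + d * (- d * ga + c * de)).
    by apply/eqP; rewrite -subr_eq0 -[X in _ == X]skew; apply/eqP; ring.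
  by rewrite {2}s'; ring.
Qed.

End EuclideanLieAlgebra.

(** * From the Lie algebra to the left-invariant frame *)

Theorem theorem13p6 (R : realType) (L : vectType R) (br : lie_bracket L)
  (dimL : \dim {: L} = 3%N) (cL : centerless br) (sL : solvable_lie_algebra br)
  (G : lieGroupType R 3) (conG : connected [set: G])
  (lieG : has_lie_algebra G br)
  (g : metric G) (riemg : riemannian g) (invg : left_invariant_metric g)
  (nabla : connection G) (LC : levi_civita g nabla)
  (U : set G) (U0 : U !=set0) (oU : open U) (conU : connected U)
  (V : subbundle G) (folV : conformal_foliation_by_geodesics g nabla U V) :
  constant_sectional_curvature g nabla.
Proof.
have [Lam [Laminj rngLam LamB]] := lieG.
have [dV _ cV gV] := folV.
have linv x : left_invariant_vfield (Lam x) by rewrite -rngLam; exists x.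
have sLam x : smooth_vfield setT (Lam x) by case: (linv x).
have tLam x p : tangent p (Lam x p) by case: (sLam x) => + _; exact.
have Lam1 x p : Lam x p = Defs.pushforward (ltranslation p) (Lam x 1%g).
  by have [_ /(_ p 1%g)] := linv x; rewrite mulg1.
have LamP c x y p : Lam (c *: x + y) p = c *: Lam x p + Lam y p.
  by rewrite linearP.
(* Left-invariant fields are determined by their values at 1 and have constant inner products, so
   the metric descends to L; injectivity of [Lam] makes it definite there. *)
pose ip x y := g 1%g (Lam x 1%g) (Lam y 1%g).
have gE p x y : g p (Lam x p) (Lam y p) = ip x y.
  by rewrite (Lam1 x) (Lam1 y) -{1}[p]mulg1 invg.
have ip_linl c u v w : ip (c *: u + v) w = c * ip u w + ip v w.
  by rewrite /ip LamP (metric_linearl riemg).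
have ipC u v : ip u v = ip v u by exact: (metricC riemg).
have ip_gt0 u : u != 0 -> 0 < ip u u.
  move=> u0; apply: (metric_gt0 riemg); first exact: tLam.
  apply: contraNneq u0 => Lu; apply/eqP/Laminj; rewrite linear0.
  by apply/funext => p; rewrite Lam1 Lu.
have [e1 [e2 [e3 [a [b [s [[e11 e22 e33] [e12 e13 e23] [b12 b13 b23] det]]]]]]] :=
  solvable_normal_form dimL ip_linl ipC ip_gt0 cL sL.
pose f := OrthonormalFrame (sLam e1) (sLam e2) (sLam e3)
  (fun p => etrans (gE p _ _) e11) (fun p => etrans (gE p _ _) e22)
  (fun p => etrans (gE p _ _) e33) (fun p => etrans (gE p _ _) e12)
  (fun p => etrans (gE p _ _) e13) (fun p => etrans (gE p _ _) e23).
have brf x y c d : br x y = c *: e2 + d *: e3 ->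
    forall p, bracket (Lam x) (Lam y) p = frame_comb f p 0 c d.
  move=> xy p; rewrite -LamB xy LamP /frame_comb scale0r add0r; congr (_ + _).
  by rewrite -[d *: e3]addr0 LamP linear0 addr0.
have f23 p : bracket (fr2 f) (fr3 f) p = 0 by rewrite -LamB b23 linear0.
pose e := AdaptedFrame (aframe := f) (brf _ _ _ _ b12) (brf _ _ _ _ b13) f23.
have [p Up] := U0.
have ab := foliation_symmetric_frame riemg LC cV gV e det dV oU Up.
(* The type of the frame mentions b, so a = b is eliminated with the frame generalized. *)
by case: _ / ab e => e; exact: (constant_curvature riemg LC e).
Qed.
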